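(* Let the boundary of a planar domain $\mathcal Z$ contain the contour $L=L_-\cup\{M\}\cup L_+$ of a corner of angle $\pi\beta\in(0,2\pi)$ with vertex $M$, let the boundary of a planar domain $\mathcal W$ contain a rectilinear segment $\mathcal I=\mathcal I_-\cup\{N\}\cup\mathcal I_+$, and let $\mathcal F:\mathcal Z\to\mathcal W$ be a harmonic map, univalent and orientation-preserving near $L$, such that $\mathcal F(L)=\mathcal I$, $\mathcal F(M)=N$, and such that, when a point $z\in L_\mp$ moves uniformly (with unit speed), the speed of its image on $\mathcal I_\mp$ is equal to a constant $\sigma_\mp$. Let the angles $\varphi$ at $M$ and $\theta$ at $N$, and the constants $\varphi^*$, $\theta^*$, be as described in the context. Let $\lambda_\varphi\subset\mathcal Z$ be a smooth Jordan curve leaving the vertex $M$ at angle $\varphi$, let $\theta$ be the angle at which its image $\mathcal F(\lambda_\varphi)$ leaves the point $N$, and let $\theta(\varphi)$ be the correspondence between these angles. Let $\Lambda_\theta\subset\mathcal W$ be a smooth Jordan curve leaving the point $N$ at angle $\theta$, let $\varphi$ be the angle at which its image $\mathcal F^{-1}(\Lambda_\theta)$ leaves the vertex $M$, and let $\varphi(\theta)$ be the correspondence between these angles. Then for $\beta\in(0,1)$ $$\theta(\varphi)=\begin{cases}0,&\varphi\in[-\pi\beta/2,\varphi^* ),\\ \theta^*,&\varphi=\varphi^*,\\ \pi,&\varphi\in(\varphi^*,\pi\beta/2],\end{cases}\qquad \varphi(\theta)=\begin{cases}-\pi\beta/2,&\theta=0,\\ \varphi^*,&\theta\in(0,\pi),\\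 \pi\beta/2,&\theta=\pi,\end{cases}$$ and for $\beta\in(1,2)$ $$\theta(\varphi)=\begin{cases}0,&\varphi=-\pi\beta/2,\\ \theta^*,&\varphi\in(-\pi\beta/2,\pi\beta/2),\\ \pi,&\varphi=\pi\beta/2,\end{cases}\qquad \varphi(\theta)=\begin{cases}-\pi\beta/2,&\theta\in(0,\theta^* ),\\ \varphi^*,&\theta=\theta^*,\\ \pi\beta/2,&\theta\in(\theta^*,\pi).\end{cases}$$
   Context: A harmonic map $\mathcal F=u+iv$ is one whose real and imaginary parts are real harmonic functions (no Cauchy–Riemann condition is imposed). Coordinates. In the $z$-plane, polar coordinates $(r,\varphi)$ are centered at $M$ so that $\mathcal Z$ contains the sector $\mathcal S=\{r\in(0,R),\ \varphi\in(-\pi\beta/2,\pi\beta/2)\}$, which adjoins $\partial\mathcal Z$ along $L$, with sides $L_\pm=\{r\in(0,R),\ \varphi=\mp\pi\beta/2\}$ (so $L_+$ is the side $\varphi=-\pi\beta/2$). In the $w$-plane, coordinates $w=u+iv=\rho e^{i\theta}$ are centered at $N$ so that $\mathcal I_+$ lies on $\theta=0$, $\mathcal I_-$ lies on $\theta=\pi$, and the part $\mathcal H\subset\mathcal W$ adjoining $\mathcal I$ lies in the upper half-plane $v>0$. The map $\mathcal F$ takes $\mathcal S$ into $\mathcal H$ injectively and gives a homeomorphism between $L$ and $\mathcal I$; $\mathcal F^{-1}$ is the inverse map near $N$. The boundary conditions read $u=-\sigma_-r$ on $L_-$, $u=\sigma_+r$ on $L_+$, $v=0$ on $L$, where $\sigma_-,\sigma_+>0$.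 Constants (for $\beta\ne1$). Put $$\mu=|\sin\pi\beta|^{-1}\sqrt{\sigma_+^2+\sigma_-^2+2\sigma_+\sigma_-\cos\pi\beta},\qquad \varphi^*=\arctan\Bigl(\frac{\sigma_+-\sigma_-}{\sigma_++\sigma_-}\tan\frac{\pi\beta}{2}\Bigr)\in\Bigl(-\frac{\pi\beta}{2},\frac{\pi\beta}{2}\Bigr).$$ The function $\mathcal F+\mu r\sin(\varphi-\varphi^* )$ is harmonic in $\mathcal S$ and vanishes on $L$; the real numbers $a_1,b_1$ are defined by its leading term, $$\mathcal F(re^{i\varphi})+\mu r\sin(\varphi-\varphi^* )=(a_1+ib_1)r^{1/\beta}\cos\frac{\varphi}{\beta}+O(r^{2/\beta}),\quad r\to0,$$ uniformly in $\varphi\in[-\pi\beta/2,\pi\beta/2]$, where $a_1\ne0$ and $b_1>0$. The angle $\theta^*=\arctan(b_1/a_1)$, with the value taken in $(0,\pi)$, is the one for which $a_1-b_1\cot\theta^*=0$.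
   Formalization: In the exceptional directions (φ=φ*; θ=0,π if β<1; φ=±πβ/2; θ=θ* if β>1) the curve must have polar angle α+o(r^κ), κ=1/β−1 (β<1), 1−1/β or β−1 (β>1); automatic for C² curves if β>1/2. Otherwise false: β=1/3, σ₊=σ₋, y=x² has image leaving at π. *)

(* Defs.v *)
From Stdlib Require Import Reals.
From Coquelicot Require Import Coquelicot.
Open Scope R_scope.

(** ** Planar sets *)

Definition connected_set (D : C -> Prop) : Prop :=
  forall U V : C -> Prop,
    open U -> open V ->
    (forall z, D z -> U z \/ V z) ->
    (exists z, D z /\ U z) -> (exists z, D z /\ V z) ->
    exists z, D z /\ U z /\ V z.

Definition planar_domain (D : C -> Prop) : Prop :=
  open D /\ connected_set D /\ exists z, D z.

Definition frontier (D : C -> Prop) (z : C) : Prop :=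
  forall eps : posreal,
    (exists w, ball z eps w /\ D w) /\ (exists w, ball z eps w /\ ~ D w).

Definition set_union (A B : C -> Prop) (z : C) : Prop := A z \/ B z.

Definition injective_on (A : C -> Prop) (F : C -> C) : Prop :=
  forall z z', A z -> A z' -> F z = F z' -> z = z'.

Definition continuous_within (A : C -> Prop) (F : C -> C) : Prop :=
  forall z, A z -> filterlim F (within A (locally z)) (locally (F z)).

Definition image (F : C -> C) (A : C -> Prop) (w : C) : Prop :=
  exists z, A z /\ F z = w.

Definition homeomorphic_onto (F : C -> C) (A B : C -> Prop) : Prop :=
  (forall w, image F A w <-> B w) /\
  continuous_within A F /\
  exists G : C -> C,
    continuous_within B G /\ forall z, A z -> G (F z) = z.

(** ** The corner at [M = 0] and the segment through [N = 0] *)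

Definition polar (r phi : R) : C := (r * cos phi, r * sin phi).

Definition sector (beta Rad : R) (z : C) : Prop :=
  exists r phi, 0 < r < Rad /\ - (PI * beta / 2) < phi < PI * beta / 2 /\
    z = polar r phi.

(** [side_plus] is the side with the negative polar angle. *)
Definition side_plus (beta Rad : R) (z : C) : Prop :=
  exists r, 0 < r < Rad /\ z = polar r (- (PI * beta / 2)).

Definition side_minus (beta Rad : R) (z : C) : Prop :=
  exists r, 0 < r < Rad /\ z = polar r (PI * beta / 2).

Definition corner_contour (beta Rad : R) (z : C) : Prop :=
  side_minus beta Rad z \/ z = 0%C \/ side_plus beta Rad z.

Definition segment (lm lp : R) (w : C) : Prop :=
  - lm < fst w < lp /\ snd w = 0.

(** [H] is a part of the open upper half-plane which, near every point of the
    segment, fills the half-plane. *)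
Definition upper_part (H : C -> Prop) (lm lp : R) : Prop :=
  open H /\ (forall w, H w -> 0 < snd w) /\
  forall p, segment lm lp p -> locally p (fun w => 0 < snd w -> H w).

(** ** Harmonic maps *)

Definition re_part (F : C -> C) (x y : R) : R := fst (F (x, y)).
Definition im_part (F : C -> C) (x y : R) : R := snd (F (x, y)).

Definition harmonic_on (D : C -> Prop) (f : R -> R -> R) : Prop :=
  forall x y, D (x, y) ->
    ex_diff_n f 2 x y /\
    partial_derive 2 0 f x y + partial_derive 0 2 f x y = 0.

Definition harmonic_map_on (D : C -> Prop) (F : C -> C) : Prop :=
  harmonic_on D (re_part F) /\ harmonic_on D (im_part F).

Definition jacobian (F : C -> C) (x y : R) : R :=
  partial_derive 1 0 (re_part F) x y * partial_derive 0 1 (im_part F) x y -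
  partial_derive 0 1 (re_part F) x y * partial_derive 1 0 (im_part F) x y.

Definition orientation_preserving_on (D : C -> Prop) (F : C -> C) : Prop :=
  forall x y, D (x, y) -> 0 < jacobian F x y.

(** [G] inverts [F : A -> B] on a neighbourhood of [0] in [B]. *)
Definition inverse_near_0 (A B : C -> Prop) (F G : C -> C) : Prop :=
  exists rho0 : R, 0 < rho0 /\
    (forall w, B w -> Cmod w < rho0 -> A (G w) /\ F (G w) = w) /\
    continuous_within (fun w => B w /\ Cmod w < rho0) G.

(** ** The constants *)

Definition mu (beta sp sm : R) : R :=
  / Rabs (sin (PI * beta)) *
  sqrt (sp ^ 2 + sm ^ 2 + 2 * sp * sm * cos (PI * beta)).

Definition phi_star (beta sp sm : R) : R :=
  atan ((sp - sm) / (sp + sm) * tan (PI * beta / 2)).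

(** The value of [arctan (b1 / a1)] in [(0, PI)], for [b1 > 0]. *)
Definition theta_star (a1 b1 : R) : R :=
  if Rlt_dec 0 a1 then atan (b1 / a1) else atan (b1 / a1) + PI.

(** [F (r e^{i phi}) + mu r sin (phi - phi_star)
      = (a1 + i b1) r^{1/beta} cos (phi / beta) + O (r^{2/beta})] as [r -> 0],
    uniformly in [phi]. *)
Definition corner_expansion (beta sp sm a1 b1 : R) (F : C -> C) : Prop :=
  exists K delta : R, 0 < delta /\
    forall r phi, 0 < r < delta ->
      - (PI * beta / 2) <= phi <= PI * beta / 2 ->
      Cmod (F (polar r phi)
            + RtoC (mu beta sp sm * r * sin (phi - phi_star beta sp sm))
            - (a1, b1) * RtoC (Rpower r (1 / beta) * cos (phi / beta)))%C
      <= K * Rpower r (2 / beta).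

(** ** Curves *)

(** An arc is the restriction to [[0, 1]] of a function on [R]; a [C^k] function
    on [[0, 1]] always extends to a [C^k] function on [R]. *)
Definition class_C (k : nat) (g : R -> C) : Prop :=
  forall (n : nat) (t : R), (n <= k)%nat ->
    (ex_derive_n (fun s => fst (g s)) n t /\
     continuous (Derive_n (fun s => fst (g s)) n) t) /\
    (ex_derive_n (fun s => snd (g s)) n t /\
     continuous (Derive_n (fun s => snd (g s)) n) t).

(** A simple [C^1] arc with nonvanishing velocity, issuing from the origin and
    otherwise lying in [D]. *)
Definition smooth_jordan_arc (D : C -> Prop) (g : R -> C) : Prop :=
  class_C 1 g /\
  (forall t, 0 <= t <= 1 ->
     (Derive (fun s => fst (g s)) t, Derive (fun s => snd (g s)) t) <> (0, 0)) /\
  (forall s t, 0 <= s <= 1 -> 0 <= t <= 1 -> g s = g t -> s = t) /\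
  g 0 = 0%C /\
  forall t, 0 < t <= 1 -> D (g t).

(** Polar angles are taken in [[lo, hi]] (a range of length less than [2 PI]):
    as [t -> 0+], [g t] tends to the origin and its polar angle to [alpha]. *)
Definition leaves_at_angle (lo hi : R) (g : R -> C) (alpha : R) : Prop :=
  forall eps : posreal, at_right 0 (fun t =>
    exists r phi, 0 < r < eps /\ lo <= phi <= hi /\ g t = polar r phi /\
      Rabs (phi - alpha) < eps).

(** The polar angle along [g] is [alpha + o (r^kappa)]. *)
Definition osculates_ray (lo hi : R) (g : R -> C) (alpha kappa : R) : Prop :=
  forall eps : posreal, at_right 0 (fun t =>
    exists r phi, 0 < r /\ lo <= phi <= hi /\ g t = polar r phi /\
      Rabs (phi - alpha) <= eps * Rpower r kappa).

(** The limiting angle of the image of a curve leaving in an exceptional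
    direction (one where the angle correspondence jumps, or which corresponds to
    a whole range of angles on the other side) is decided by the relative size of [r] and
    [r^{1/beta}], hence depends on the contact of the curve with its tangent ray
    and not on its initial direction alone.  For instance, if
    [beta = 1/3], [sp = sm] and
    [F = - mu y + (a1 + i b1) (x^3 - 3 x y^2)], then [phi_star = 0], but the
    image of the parabola [y = x^2] leaves at the angle [PI], whereas that of its
    tangent ray leaves at [theta_star].

    For a [C^2] arc the polar angle is [alpha + O (r)], so that contact of
    order [kappa < 1] is automatic; straight rays have contact of every order. *)
Definition tangent_contact (lo hi : R) (g : R -> C) (alpha kappa : R) : Prop :=
  (kappa < 1 /\ class_C 2 g) \/ osculates_ray lo hi g alpha kappa.

(* Main.v *)
Require Import Defs.
From Stdlib Require Import Reals Lra ClassicalEpsilon.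
From Coquelicot Require Import Coquelicot.
Open Scope R_scope.

(** Write [p] for [r^{1/beta}].  Near the vertex the corner expansion reads

      [u = - mu r sin (phi - phi_star) + a1 p cos (phi / beta) + O (p^2)],
      [v = b1 p cos (phi / beta) + O (p^2)],

    and since [beta < 2] the error is small compared with both [r] and [p].
    Everything is a competition between the scales [r] and [p]: for [beta < 1]
    the linear term wins, for [beta > 1] the power term wins.

    Images.  If the linear term wins, the image is asymptotic to the real axis,
    on the side given by the sign of [- sin (phi - phi_star)]; if the power term
    wins, the direction is that of [a1 + i b1], namely [theta_star].  In the
    exceptional directions the winning coefficient vanishes: it is
    [sin (phi - phi_star)] for [beta < 1] and [cos (phi / beta)] for [beta > 1].
    The contact hypothesis makes it so small that the other term wins there.
    Both situations are covered by [corner_limit_linear_scale] and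
    [corner_limit_power_scale], whose hypothesis is just that one term is
    negligible on the scale of the other.

    Preimages.  Let [theta] be the polar angle of the image point.  With
    [a1 + i b1 = R0 exp (i theta_star)], the identity
    [u sin theta - v cos theta = 0] becomes

      [mu r sin (phi - phi_star) sin theta
         = R0 p cos (phi / beta) sin (theta - theta_star) + O (p^2)].

    If the right-hand side is [o (r)] and [sin theta] stays away from [0], then
    [sin (phi - phi_star)] tends to [0] and [phi] to [phi_star]
    ([preimage_tends_to_phi_star]); this happens for [beta < 1] and for
    [theta = theta_star], [beta > 1].  In the remaining cases [cos (phi / beta)]
    is forced to [0], so that [phi] approaches the two sides of the corner, and a
    one-sided bound on [sin (phi - phi_star)] selects the side
    ([tends_to_side]).  For [theta] equal to [0] or [PI] the first fact comes from
    [v] and the second from the sign of [u]; for [beta > 1] both come from the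
    identity above.

    Angles are recovered from trigonometric limits by compactness: a continuous
    function with a single zero on an interval locates that zero
    ([lim0_of_unique_zero]).  Contact of order less than one is automatic for an
    arc of class C^2 because its distance to the tangent line is quadratic
    ([C2_arc_contact]). *)

(** * Limits as the parameter of an arc tends to zero from the right *)

Definition lim0 (f : R -> R) (l : R) : Prop := filterlim f (at_right 0) (locally l).

Tactic Notation "eventually" constr(H) "as" simple_intropattern(p) :=
  refine (filter_imp (F := at_right 0) _ _ _ H); intros t p.

Lemma at_right_intro (P : R -> Prop) (d : R) :
  0 < d -> (forall t, 0 < t < d -> P t) -> at_right 0 P.
Proof.
  intros hd h. exists (mkposreal d hd). intros t ht ht0. apply h.
  split; [exact ht0|]. change (Rabs (t - 0) < d) in ht. apply Rabs_def2 in ht. lra.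
Qed.

Lemma lim0_iff (f : R -> R) (l : R) :
  lim0 f l <-> forall eps, 0 < eps -> at_right 0 (fun t => Rabs (f t - l) < eps).
Proof.
  unfold lim0. rewrite filterlim_locally. split.
  - intros h eps he. exact (h (mkposreal eps he)).
  - intros h eps. exact (h eps (cond_pos eps)).
Qed.

Lemma lim0_ext (f g : R -> R) (l : R) :
  at_right 0 (fun t => f t = g t) -> lim0 f l -> lim0 g l.
Proof. intros h. apply filterlim_ext_loc. exact h. Qed.

Lemma lim0_const (c : R) : lim0 (fun _ => c) c.
Proof. apply filterlim_const. Qed.

Lemma lim0_plus (f g : R -> R) (l m : R) :
  lim0 f l -> lim0 g m -> lim0 (fun t => f t + g t) (l + m).
Proof.
  intros hf hg.
  exact (filterlim_comp_2 _ _ _ hf hg (filterlim_plus (V := R_NormedModule) l m)).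
Qed.

Lemma lim0_mult (f g : R -> R) (l m : R) :
  lim0 f l -> lim0 g m -> lim0 (fun t => f t * g t) (l * m).
Proof.
  intros hf hg.
  exact (filterlim_comp_2 _ _ _ hf hg (filterlim_mult (K := R_AbsRing) l m)).
Qed.

Lemma lim0_comp (f : R -> R) (g : R -> R) (l : R) :
  lim0 f l -> continuous g l -> lim0 (fun t => g (f t)) (g l).
Proof. intros hf hg. exact (filterlim_comp _ _ _ _ _ _ _ _ hf hg). Qed.

Lemma lim0_minus (f g : R -> R) (l m : R) :
  lim0 f l -> lim0 g m -> lim0 (fun t => f t - g t) (l - m).
Proof.
  intros hf hg. apply lim0_plus; [exact hf|].
  apply (lim0_comp g Ropp); [exact hg|]. apply (continuous_opp (fun x : R => x)), continuous_id.
Qed.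

Lemma lim0_div (f g : R -> R) (l m : R) :
  m <> 0 -> lim0 f l -> lim0 g m -> lim0 (fun t => f t / g t) (l / m).
Proof.
  intros hm hf hg. apply lim0_mult; [exact hf|].
  apply (lim0_comp g Rinv); [exact hg|]. now apply continuous_Rinv.
Qed.

Lemma lim0_squeeze (f g : R -> R) :
  at_right 0 (fun t => Rabs (f t) <= g t) -> lim0 g 0 -> lim0 f 0.
Proof.
  rewrite !lim0_iff. intros h hg eps he.
  eventually (filter_and _ _ h (hg eps he)) as [h1 h2].
  revert h1 h2. unfold Rabs; repeat destruct Rcase_abs; lra.
Qed.

Lemma lim0_bounded_mult (f g : R -> R) (M : R) :
  at_right 0 (fun t => Rabs (f t) <= M) -> lim0 g 0 -> lim0 (fun t => f t * g t) 0.
Proof.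
  intros h hg. apply (lim0_squeeze _ (fun t => M * Rabs (g t))).
  - eventually h as hM. rewrite Rabs_mult.
    apply Rmult_le_compat_r; [apply Rabs_pos|exact hM].
  - replace 0 with (M * Rabs 0) by (rewrite Rabs_R0; ring).
    apply lim0_mult; [apply lim0_const|].
    apply (lim0_comp g Rabs); [exact hg|]. apply continuous_Rabs.
Qed.

Lemma lim0_near (f : R -> R) (l eps : R) :
  0 < eps -> lim0 f l -> at_right 0 (fun t => l - eps < f t < l + eps).
Proof.
  intros he h. eventually (proj1 (lim0_iff f l) h eps he) as ht.
  apply Rabs_def2 in ht. lra.
Qed.

Lemma lim0_unique (f : R -> R) (l m : R) : lim0 f l -> lim0 f m -> l = m.
Proof.
  intros hl hm.
  exact (filterlim_locally_unique (F := at_right 0) f l m hl hm).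
Qed.

Lemma eventually_le_of_negligible (x s : R -> R) :
  at_right 0 (fun t => 0 < s t) -> lim0 (fun t => x t / s t) 0 ->
  at_right 0 (fun t => x t <= s t).
Proof.
  intros hs h. eventually (filter_and _ _ hs (lim0_near _ _ 1 Rlt_0_1 h)) as [h1 h2].
  assert (e : x t = x t / s t * s t) by (field; lra). rewrite e. nra.
Qed.

(** By compactness [f] has a positive minimum away from its zero [x0], so that
    small values of [f] can only be taken near [x0]. *)
Lemma lim0_of_unique_zero (lo hi x0 : R) (f x : R -> R) :
  (forall y, continuous f y) ->
  (forall y, lo <= y <= hi -> f y <= 0 -> y = x0) ->
  at_right 0 (fun t => lo <= x t <= hi) ->
  lim0 (fun t => f (x t)) 0 -> lim0 x x0.
Proof.
  intros hc hz hx hf. apply lim0_iff. intros eps he.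
  assert (key : forall a b, lo <= a -> b <= hi -> (b < x0 \/ x0 < a) ->
    at_right 0 (fun t => a <= x t <= b -> False)).
  { intros a b ha hb hab. destruct (Rle_dec a b) as [hle|hle].
    - destruct (continuity_ab_min f a b hle) as [m [hm1 hm2]].
      { intros c _. apply continuity_pt_filterlim, hc. }
      assert (hpos : 0 < f m).
      { destruct (Rle_dec (f m) 0) as [h|h]; [|lra].
        specialize (hz m ltac:(lra) h). lra. }
      eventually (lim0_near _ _ (f m) hpos hf) as ht. intros hxt.
      specialize (hm1 _ hxt). lra.
    - apply filter_forall. intros t. lra. }
  pose proof (key lo (Rmin hi (x0 - eps)) (Rle_refl _) (Rmin_l _ _)
    ltac:(left; pose proof (Rmin_r hi (x0 - eps)); lra)) as kl.
  pose proof (key (Rmax lo (x0 + eps)) hi (Rmax_l _ _) (Rle_refl _)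
    ltac:(right; pose proof (Rmax_r lo (x0 + eps)); lra)) as kr.
  eventually (filter_and _ _ hx (filter_and _ _ kl kr)) as [h1 [h2 h3]].
  apply Rabs_def1.
  - destruct (Rlt_dec (x t - x0) eps) as [h|h]; [exact h|].
    exfalso. apply h3. split; [apply Rmax_lub|]; lra.
  - destruct (Rlt_dec (- eps) (x t - x0)) as [h|h]; [exact h|].
    exfalso. apply h2. split; [|apply Rmin_glb]; lra.
Qed.

(** * Elementary estimates for sines, cosines and powers *)

Lemma Rabs_sin_le (x : R) : Rabs (sin x) <= Rabs x.
Proof.
  assert (H : forall y, 0 <= y -> Rabs (sin y) <= y).
  { intros y hy. destruct (Rle_dec y 1) as [h|h].
    - destruct (Req_dec y 0) as [->|hne]; [rewrite sin_0, Rabs_R0; lra|].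
      pose proof PI_RGT_0. pose proof PI2_1.
      rewrite Rabs_pos_eq; [left; apply sin_lt_x; lra|].
      apply sin_ge_0; lra.
    - pose proof (SIN_bound y). apply Rabs_le. lra. }
  destruct (Rle_dec 0 x) as [h|h].
  - rewrite (Rabs_pos_eq x h). now apply H.
  - rewrite <- (Rabs_Ropp x), <- (Rabs_Ropp (sin x)), <- sin_neg.
    rewrite (Rabs_pos_eq (- x)) by lra. apply H. lra.
Qed.

Lemma Rabs_le_twice_sin : exists d, 0 < d /\ forall x, Rabs x < d -> Rabs x <= 2 * Rabs (sin x).
Proof.
  destruct (derivable_pt_lim_sin_0 (1 / 2) ltac:(lra)) as [d hd].
  exists d. split; [apply cond_pos|]. intros x hx.
  destruct (Req_dec x 0) as [->|hne]; [rewrite sin_0, Rabs_R0; lra|].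
  specialize (hd x hne hx). rewrite Rplus_0_l, sin_0, Rminus_0_r in hd.
  apply Rabs_def2 in hd. destruct hd as [_ hd].
  assert (hq : Rabs (sin x) = Rabs (sin x / x) * Rabs x).
  { rewrite <- Rabs_mult. f_equal. field. exact hne. }
  rewrite hq. rewrite (Rabs_pos_eq (sin x / x)) by lra.
  pose proof (Rabs_pos x). nra.
Qed.

Lemma Rabs_sin_le_1 (x : R) : Rabs (sin x) <= 1.
Proof. apply Rabs_le, SIN_bound. Qed.

Lemma Rabs_cos_le_1 (x : R) : Rabs (cos x) <= 1.
Proof. apply Rabs_le, COS_bound. Qed.

Lemma sin_eq_0_in_period (x : R) : - PI < x < PI -> sin x = 0 -> x = 0.
Proof.
  intros hx h. destruct (Rtotal_order x 0) as [h1|[h1|h1]]; [|exact h1|].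
  - pose proof (sin_gt_0 (- x)) as h2. rewrite sin_neg in h2. lra.
  - pose proof (sin_gt_0 x). lra.
Qed.

Lemma Rabs_combination_le (x y a b : R) :
  Rabs x <= 1 -> Rabs y <= 1 -> Rabs (a * x - b * y) <= Rabs a + Rabs b.
Proof.
  intros hx hy. eapply Rle_trans; [apply Rabs_triang|].
  rewrite Rabs_Ropp, !Rabs_mult. pose proof (Rabs_pos a). pose proof (Rabs_pos b). nra.
Qed.

Lemma continuous_sin_shift (c x : R) : continuous (fun y => sin (y - c)) x.
Proof.
  apply continuous_sin_comp.
  apply (continuous_minus (fun y : R => y) (fun _ => c));
    [apply continuous_id|apply continuous_const].
Qed.

Lemma continuous_cos_shift (c x : R) : continuous (fun y => cos (y - c)) x.
Proof.
  apply continuous_cos_comp.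
  apply (continuous_minus (fun y : R => y) (fun _ => c));
    [apply continuous_id|apply continuous_const].
Qed.

Lemma continuous_cos_scaled (c x : R) : continuous (fun y => cos (y / c)) x.
Proof.
  apply continuous_cos_comp.
  apply (continuous_mult (K := R_AbsRing) (fun y : R => y) (fun _ => / c));
    [apply continuous_id|apply continuous_const].
Qed.

Lemma lim0_sin_shift (phi : R -> R) (phi0 c : R) :
  lim0 phi phi0 -> lim0 (fun t => sin (phi t - c)) (sin (phi0 - c)).
Proof.
  intros h. apply (lim0_comp phi (fun y => sin (y - c))); [exact h|apply continuous_sin_shift].
Qed.

Lemma lim0_cos_scaled (phi : R -> R) (phi0 c : R) :
  lim0 phi phi0 -> lim0 (fun t => cos (phi t / c)) (cos (phi0 / c)).
Proof.
  intros h. apply (lim0_comp phi (fun y => cos (y / c))); [exact h|apply continuous_cos_scaled].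
Qed.

Lemma lim0_Rpower (r : R -> R) (q : R) :
  0 < q -> at_right 0 (fun t => 0 < r t) -> lim0 r 0 ->
  lim0 (fun t => Rpower (r t) q) 0.
Proof.
  intros hq hpos hr. apply lim0_iff. intros eps he.
  eventually (filter_and _ _ hpos
    (lim0_near r 0 (Rpower eps (/ q)) (exp_pos _) hr)) as [h1 h2].
  rewrite Rminus_0_r, Rabs_pos_eq by apply Rlt_le, exp_pos.
  replace eps with (Rpower (Rpower eps (/ q)) q).
  - apply Rlt_Rpower_l; lra.
  - rewrite Rpower_mult, Rinv_l, Rpower_1; lra.
Qed.

Lemma Rpower_ratio (x p q : R) : Rpower x p / Rpower x q = Rpower x (p - q).
Proof. unfold Rminus. rewrite Rpower_plus, Rpower_Ropp. reflexivity. Qed.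

Lemma lim0_power_ratio_small (beta : R) (r : R -> R) :
  0 < beta < 1 -> at_right 0 (fun t => 0 < r t) -> lim0 r 0 ->
  lim0 (fun t => Rpower (r t) (1 / beta) / r t) 0.
Proof.
  intros hb hpos hr.
  assert (q : 0 < 1 / beta - 1).
  { apply (Rmult_lt_reg_r beta); [lra|]. rewrite Rmult_minus_distr_r.
    unfold Rdiv. rewrite Rmult_assoc, Rinv_l by lra. lra. }
  refine (lim0_ext _ _ _ _ (lim0_Rpower r _ q hpos hr)).
  eventually hpos as h. rewrite <- Rpower_ratio, (Rpower_1 (r t)) by exact h. reflexivity.
Qed.

Lemma lim0_power_ratio_large (beta : R) (r : R -> R) :
  1 < beta -> at_right 0 (fun t => 0 < r t) -> lim0 r 0 ->
  lim0 (fun t => r t / Rpower (r t) (1 / beta)) 0.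
Proof.
  intros hb hpos hr.
  assert (q : 0 < 1 - 1 / beta).
  { apply (Rmult_lt_reg_r beta); [lra|]. rewrite Rmult_minus_distr_r.
    unfold Rdiv. rewrite Rmult_assoc, Rinv_l by lra. lra. }
  refine (lim0_ext _ _ _ _ (lim0_Rpower r _ q hpos hr)).
  eventually hpos as h. rewrite <- Rpower_ratio, (Rpower_1 (r t)) by exact h. reflexivity.
Qed.

(** Smallness relative to a power of [rho] passes to any scale [s] that
    dominates [rho], because the ratio of the two powers is bounded. *)
Lemma lim0_Rpower_transfer (x s rho : R -> R) (M q : R) :
  0 <= q ->
  at_right 0 (fun t => 0 < s t) -> at_right 0 (fun t => 0 < rho t <= M * s t) ->
  lim0 (fun t => x t / Rpower (rho t) q) 0 -> lim0 (fun t => x t / Rpower (s t) q) 0.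
Proof.
  intros hq hs hrho hx.
  refine (lim0_ext (fun t => Rpower (rho t) q / Rpower (s t) q * (x t / Rpower (rho t) q))
    _ _ _ (lim0_bounded_mult _ _ (Rpower M q) _ hx)).
  - apply (filter_forall (F := at_right 0)). intros t. field. split; apply Rgt_not_eq, exp_pos.
  - eventually (filter_and _ _ hs hrho) as [h1 h2].
    assert (hM : 0 < M) by nra.
    assert (hpw : 0 < Rpower (s t) q) by apply exp_pos.
    rewrite Rabs_pos_eq.
    2:{ apply Rlt_le, Rdiv_lt_0_compat; apply exp_pos. }
    apply (Rmult_le_reg_r (Rpower (s t) q)); [exact hpw|].
    unfold Rdiv. rewrite Rmult_assoc, Rinv_l, Rmult_1_r by lra.
    rewrite Rpower_mult_distr by assumption. apply Rle_Rpower_l; lra.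
Qed.

(** * Polar coordinates along an arc *)

Definition polar_point (lo hi : R) (z : C) (r phi : R) : Prop :=
  0 < r /\ lo <= phi <= hi /\ z = polar r phi.

(** The chosen polar coordinates are determined by [z] when the window has
    length less than [2 PI] ([polar_coords_unique]); elsewhere the value is
    arbitrary. *)
Definition polar_coords (lo hi : R) (z : C) : R * R :=
  epsilon (inhabits (0, 0)) (fun p => polar_point lo hi z (fst p) (snd p)).

Lemma polar_sum_squares (r phi : R) : (r * cos phi) ^ 2 + (r * sin phi) ^ 2 = r ^ 2.
Proof.
  pose proof (sin2_cos2 phi) as e. unfold Rsqr in e.
  transitivity (r ^ 2 * (sin phi * sin phi + cos phi * cos phi)); [ring|rewrite e; ring].
Qed.

Lemma Cmod_polar (r phi : R) : 0 <= r -> Cmod (polar r phi) = r.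
Proof.
  intros hr. unfold Cmod. change (sqrt ((r * cos phi) ^ 2 + (r * sin phi) ^ 2) = r).
  rewrite polar_sum_squares. now apply sqrt_pow2.
Qed.

Lemma polar_near_vertex (r phi : R) (eps : posreal) :
  0 < r -> ball (0%C : C) eps (polar r phi) -> r < 2 * eps.
Proof.
  intros hr [h1 h2].
  change (Rabs (r * cos phi - 0) < eps) in h1. change (Rabs (r * sin phi - 0) < eps) in h2.
  rewrite Rminus_0_r in h1, h2. apply Rabs_def2 in h1, h2.
  pose proof (polar_sum_squares r phi) as e. pose proof (cond_pos eps).
  destruct (Rlt_dec r (2 * eps)) as [h|h]; [exact h|]. exfalso.
  assert ((r * cos phi) ^ 2 < eps ^ 2) by nra.
  assert ((r * sin phi) ^ 2 < eps ^ 2) by nra. nra.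
Qed.

Lemma polar_eq_radius (r s phi psi : R) :
  0 < r -> 0 < s -> polar r phi = polar s psi -> r = s.
Proof.
  intros hr hs h. apply (f_equal Cmod) in h. rewrite !Cmod_polar in h; lra.
Qed.

Lemma polar_eq_angle (lo hi r phi psi : R) :
  hi - lo < 2 * PI -> 0 < r -> lo <= phi <= hi -> lo <= psi <= hi ->
  polar r phi = polar r psi -> phi = psi.
Proof.
  intros hw hr h1 h2 h. injection h as hc hs.
  apply Rmult_eq_reg_l in hc; [|lra]. apply Rmult_eq_reg_l in hs; [|lra].
  assert (hcos : cos (phi - psi) = 1).
  { rewrite cos_minus, hc, hs. pose proof (sin2_cos2 psi) as e. unfold Rsqr in e. lra. }
  assert (hsin : sin ((phi - psi) / 2) = 0).
  { replace (phi - psi) with (2 * ((phi - psi) / 2)) in hcos by field.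
    rewrite cos_2a_sin in hcos. nra. }
  apply sin_eq_0_in_period in hsin; lra.
Qed.

Lemma polar_coords_unique (lo hi : R) (z : C) (r phi : R) :
  hi - lo < 2 * PI -> polar_point lo hi z r phi -> polar_coords lo hi z = (r, phi).
Proof.
  intros hw h.
  assert (hp : polar_point lo hi z (fst (polar_coords lo hi z)) (snd (polar_coords lo hi z))).
  { apply (epsilon_spec (inhabits (0, 0))
      (fun p => polar_point lo hi z (fst p) (snd p))). now exists (r, phi). }
  destruct (polar_coords lo hi z) as [s psi]; simpl in hp.
  destruct h as [h1 [h2 h3]]. destruct hp as [p1 [p2 p3]].
  rewrite h3 in p3. pose proof (polar_eq_radius _ _ _ _ h1 p1 p3) as ->.
  now rewrite (polar_eq_angle lo hi s phi psi hw h1 h2 p2 p3).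
Qed.

(** A choice of polar coordinates along an arc tending to the origin; it turns
    the existential quantifiers in [leaves_at_angle] into limits of two real
    functions. *)
Record polar_lift (lo hi : R) (g : R -> C) (r phi : R -> R) : Prop := {
  lift_point : at_right 0 (fun t => polar_point lo hi (g t) (r t) (phi t));
  lift_radius : lim0 r 0 }.

Lemma polar_lift_exists (lo hi : R) (g : R -> C) :
  (forall eps, 0 < eps ->
     at_right 0 (fun t => exists r phi, r < eps /\ polar_point lo hi (g t) r phi)) ->
  exists r phi, polar_lift lo hi g r phi.
Proof.
  intros h.
  exists (fun t => fst (polar_coords lo hi (g t))), (fun t => snd (polar_coords lo hi (g t))).
  assert (hp : at_right 0 (fun t => polar_point lo hi (g t)
    (fst (polar_coords lo hi (g t))) (snd (polar_coords lo hi (g t))))).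
  { eventually (h 1 Rlt_0_1) as [r [phi [_ hr]]].
    apply (epsilon_spec (inhabits (0, 0))
      (fun p => polar_point lo hi (g t) (fst p) (snd p))). now exists (r, phi). }
  split; [exact hp|].
  apply lim0_iff. intros eps he.
  eventually (filter_and _ _ hp (h eps he)) as [[h1 [h2 h3]] [r [phi [h4 [h5 [h6 h7]]]]]].
  rewrite h3 in h7. apply polar_eq_radius in h7; [|lra|lra].
  rewrite h7, Rabs_pos_eq; lra.
Qed.

Lemma polar_lift_tends_to_vertex (lo hi : R) (g : R -> C) (r phi : R -> R) :
  polar_lift lo hi g r phi -> filterlim g (at_right 0) (locally (0%C : C)).
Proof.
  intros [hl hr]. apply (filterlim_locally (F := at_right 0)). intros eps.
  eventually (filter_and _ _ hl (lim0_near _ _ eps (cond_pos eps) hr)) as [[h1 [h2 ->]] h3].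
  assert (k : forall c, Rabs c <= 1 -> Rabs (r t * c) < eps).
  { intros c hc. rewrite Rabs_mult, (Rabs_pos_eq (r t)) by lra. pose proof (Rabs_pos c). nra. }
  split.
  - change (Rabs (r t * cos (phi t) - 0) < eps). rewrite Rminus_0_r. apply k, Rabs_cos_le_1.
  - change (Rabs (r t * sin (phi t) - 0) < eps). rewrite Rminus_0_r. apply k, Rabs_sin_le_1.
Qed.

Lemma leaves_at_angle_lift (lo hi alpha : R) (g : R -> C) :
  hi - lo < 2 * PI -> leaves_at_angle lo hi g alpha ->
  exists r phi, polar_lift lo hi g r phi /\ lim0 phi alpha.
Proof.
  intros hw h. destruct (polar_lift_exists lo hi g) as [r [phi hl]].
  { intros eps he. eventually (h (mkposreal eps he)) as [r [phi [h1 [h2 [h3 h4]]]]].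
    simpl in h1. exists r, phi. repeat split; tauto. }
  exists r, phi. split; [exact hl|]. apply lim0_iff. intros eps he.
  eventually (filter_and _ _ (lift_point _ _ _ _ _ hl) (h (mkposreal eps he)))
    as [hp [s [psi [h1 [h2 [h3 h4]]]]]].
  assert (hq : polar_point lo hi (g t) s psi) by (repeat split; tauto).
  apply (polar_coords_unique _ _ _ _ _ hw) in hp, hq.
  rewrite hp in hq. injection hq as _ ->. exact h4.
Qed.

Lemma leaves_at_angle_of_lift (lo hi alpha : R) (g : R -> C) (r phi : R -> R) :
  polar_lift lo hi g r phi -> lim0 phi alpha -> leaves_at_angle lo hi g alpha.
Proof.
  intros [hp hr] hphi eps.
  eventually (filter_and _ _ hp (filter_and _ _ (lim0_near _ _ _ (cond_pos eps) hr)
    (proj1 (lim0_iff _ _) hphi eps (cond_pos eps)))) as [[h1 [h2 h3]] [h4 h5]].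
  exists (r t), (phi t). repeat split; lra || assumption.
Qed.

(** The arc cosine takes its values in [[0, PI]], which makes it the polar
    angle on the whole closed upper half-plane, with no case distinction. *)
Lemma polar_point_upper (w : C) :
  w <> 0%C -> 0 <= snd w -> exists rho theta, polar_point 0 PI w rho theta.
Proof.
  intros hw hv. destruct w as [u v]; simpl in hv.
  set (rho := sqrt (u ^ 2 + v ^ 2)).
  assert (hpos : 0 < u ^ 2 + v ^ 2).
  { destruct (Req_dec u 0) as [->|hu]; [|nra].
    destruct (Req_dec v 0) as [->|hv']; [now destruct hw|nra]. }
  assert (hrho : 0 < rho) by now apply sqrt_lt_R0.
  assert (hsq : rho ^ 2 = u ^ 2 + v ^ 2) by (apply pow2_sqrt; lra).
  assert (e : (u / rho) * rho = u) by (field; lra).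
  assert (e2 : (u / rho) ^ 2 * rho ^ 2 = u ^ 2) by (rewrite <- Rpow_mult_distr, e; ring).
  assert (hq : (u / rho) ^ 2 <= 1) by (apply (Rmult_le_reg_r (rho ^ 2)); nra).
  assert (hb : -1 <= u / rho <= 1) by (split; nra).
  exists rho, (acos (u / rho)). repeat split; [exact hrho|apply acos_bound|apply acos_bound|].
  unfold polar. rewrite cos_acos, sin_acos by exact hb. f_equal; [lra|].
  replace (1 - (u / rho)²) with ((v / rho) ^ 2).
  - rewrite sqrt_pow2; [field; lra|]. apply Rmult_le_pos; [exact hv|].
    apply Rlt_le, Rinv_0_lt_compat, hrho.
  - unfold Rsqr. transitivity (v ^ 2 / rho ^ 2); [field; lra|].
    replace (v ^ 2) with (rho ^ 2 - u ^ 2) by (rewrite hsq; ring). field. lra.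
Qed.

(** After division by a scale [s] the arc converges to a nonzero vector, so its
    direction converges to that of the vector. *)
Lemma leaves_at_angle_of_direction (g : R -> C) (s : R -> R) (R0 theta : R) :
  0 < R0 -> 0 <= theta <= PI ->
  at_right 0 (fun t => 0 < s t) -> lim0 s 0 ->
  at_right 0 (fun t => 0 <= snd (g t)) ->
  lim0 (fun t => fst (g t) / s t) (R0 * cos theta) ->
  lim0 (fun t => snd (g t) / s t) (R0 * sin theta) ->
  leaves_at_angle 0 PI g theta.
Proof.
  intros hR ht spos hs0 hv hu1 hv1.
  pose proof (sin2_cos2 theta) as sc. unfold Rsqr in sc.
  set (m := fun t => sqrt ((fst (g t) / s t) ^ 2 + (snd (g t) / s t) ^ 2)).
  assert (hm : lim0 m R0).
  { replace R0 with (sqrt ((R0 * cos theta) * (R0 * cos theta)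
      + (R0 * sin theta) * (R0 * sin theta))).
    - refine (lim0_ext _ _ _ _ (lim0_comp _ sqrt _ (lim0_plus _ _ _ _
        (lim0_mult _ _ _ _ hu1 hu1) (lim0_mult _ _ _ _ hv1 hv1)) _)).
      + eventually spos as _. unfold m. f_equal. ring.
      + apply continuous_sqrt.
    - replace (R0 * cos theta * (R0 * cos theta) + R0 * sin theta * (R0 * sin theta))
        with (R0 ^ 2 * (sin theta * sin theta + cos theta * cos theta)) by ring.
      rewrite sc, Rmult_1_r. apply sqrt_pow2. lra. }
  (* [m] is the ratio of the modulus of [g] to the scale [s] *)
  assert (hmod : forall t rho psi, 0 < s t -> 0 < rho -> g t = polar rho psi ->
    rho = s t * m t).
  { intros t rho psi h1 h2 h3. unfold m. rewrite h3. simpl.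
    replace (rho * cos psi / s t * (rho * cos psi / s t * 1) +
      rho * sin psi / s t * (rho * sin psi / s t * 1)) with ((rho / s t) ^ 2).
    - rewrite sqrt_pow2; [field; lra|]. apply Rmult_le_pos; [lra|].
      apply Rlt_le, Rinv_0_lt_compat, h1.
    - pose proof (sin2_cos2 psi) as e. unfold Rsqr in e.
      transitivity ((rho / s t) ^ 2 * (sin psi * sin psi + cos psi * cos psi));
        [rewrite e; ring|field; lra]. }
  assert (hsm : lim0 (fun t => s t * m t) 0).
  { replace 0 with (0 * R0) by ring. now apply lim0_mult. }
  assert (hmpos := lim0_near _ _ R0 hR hm).
  destruct (polar_lift_exists 0 PI g) as [rho [psi hl]].
  { intros eps he.
    eventually (filter_and _ _ (filter_and _ _ spos hv)
      (filter_and _ _ hmpos (lim0_near _ _ eps he hsm))) as [[h1 h2] [h3 h4]].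
    destruct (polar_point_upper (g t)) as [rho [psi hp]].
    - intros hg. revert h3. unfold m. rewrite hg. simpl.
      unfold Rdiv. rewrite !Rmult_0_l, Rplus_0_l, sqrt_0. lra.
    - exact h2.
    - exists rho, psi. split; [|exact hp]. destruct hp as [p1 [p2 p3]].
      rewrite (hmod _ _ _ h1 p1 p3). lra. }
  apply (leaves_at_angle_of_lift 0 PI theta g rho psi hl).
  apply (lim0_of_unique_zero 0 PI theta (fun x => Rabs (cos x - cos theta))).
  - intros y. apply continuous_Rabs_comp.
    apply (continuous_minus (V := R_NormedModule) cos (fun _ => cos theta));
      [apply continuous_cos|apply continuous_const].
  - intros y hy h. apply cos_inj; [exact hy|exact ht|].
    pose proof (Rabs_pos (cos y - cos theta)) as h0.
    destruct (Req_dec (cos y - cos theta) 0) as [h1|h1]; [lra|].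
    apply Rabs_pos_lt in h1. lra.
  - eventually (lift_point _ _ _ _ _ hl) as h. apply h.
  - replace 0 with (Rabs (cos theta - cos theta)) by (rewrite Rminus_diag; apply Rabs_R0).
    apply (lim0_comp (fun t => cos (psi t)) (fun x => Rabs (x - cos theta))).
    + replace (cos theta) with (R0 * cos theta / R0) by (field; lra).
      refine (lim0_ext _ _ _ _ (lim0_div _ _ _ _ (Rgt_not_eq _ _ hR) hu1 hm)).
      eventually (filter_and _ _ spos (filter_and _ _ hmpos (lift_point _ _ _ _ _ hl)))
        as [h1 [h2 [h3 [h4 h5]]]].
      pose proof (hmod _ _ _ h1 h3 h5) as e. rewrite h5. simpl. rewrite e. field. lra.
    + apply continuous_Rabs_comp.
      apply (continuous_minus (V := R_NormedModule) (fun x : R => x) (fun _ => cos theta));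
        [apply continuous_id|apply continuous_const].
Qed.

(** * Contact of an arc with its tangent ray *)

(** The polar angle is unique in the window, so the angles provided by
    [osculates_ray] are those of the given lift. *)
Lemma osculates_ray_contact (lo hi alpha kappa : R) (g : R -> C) (r phi : R -> R) :
  hi - lo < 2 * PI -> polar_lift lo hi g r phi -> osculates_ray lo hi g alpha kappa ->
  lim0 (fun t => (phi t - alpha) / Rpower (r t) kappa) 0.
Proof.
  intros hw hl h. apply lim0_iff. intros eps he.
  assert (he2 : 0 < eps / 2) by lra.
  eventually (filter_and _ _ (lift_point _ _ _ _ _ hl) (h (mkposreal _ he2)))
    as [hp [s [psi [h1 [h2 [h3 h4]]]]]].
  assert (hq : polar_point lo hi (g t) s psi) by (repeat split; tauto).
  apply (polar_coords_unique _ _ _ _ _ hw) in hp, hq.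
  rewrite hp in hq. injection hq as -> ->. simpl in h4.
  assert (hpos : 0 < Rpower s kappa) by apply exp_pos.
  rewrite Rminus_0_r. unfold Rdiv. rewrite Rabs_mult, (Rabs_pos_eq (/ _)).
  - apply (Rmult_lt_reg_r (Rpower s kappa)); [exact hpos|].
    rewrite Rmult_assoc, Rinv_l by lra. nra.
  - apply Rlt_le, Rinv_0_lt_compat, hpos.
Qed.

Lemma quotient_lim0_Derive (f : R -> R) :
  ex_derive f 0 -> f 0 = 0 -> lim0 (fun t => f t / t) (Derive f 0).
Proof.
  intros hd h0. apply lim0_iff. intros eps he.
  apply Derive_correct, is_derive_Reals in hd.
  destruct (hd eps he) as [d h].
  apply (at_right_intro _ d (cond_pos d)). intros t ht.
  specialize (h t ltac:(lra)). rewrite Rplus_0_l, h0, Rminus_0_r in h.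
  apply h. rewrite Rabs_pos_eq; lra.
Qed.

Lemma second_order_remainder (f : R -> R) :
  (forall n t, (n <= 2)%nat -> ex_derive_n f n t /\ continuous (Derive_n f n) t) ->
  f 0 = 0 ->
  exists M, at_right 0 (fun t => Rabs (f t - Derive f 0 * t) <= M * t ^ 2).
Proof.
  intros hC h0. set (M := Rabs (Derive_n f 2 0) + 1). exists M.
  destruct (hC 2%nat 0 ltac:(auto)) as [_ hc].
  assert (hb : locally 0 (fun t => Rabs (Derive_n f 2 t) < M)).
  { apply (filter_imp (fun t => Rabs (Derive_n f 2 t - Derive_n f 2 0) < 1)).
    - intros t ht. unfold M.
      pose proof (Rabs_triang (Derive_n f 2 t - Derive_n f 2 0) (Derive_n f 2 0)) as h.
      replace (Derive_n f 2 t - Derive_n f 2 0 + Derive_n f 2 0)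
        with (Derive_n f 2 t) in h by ring. lra.
    - exact (proj1 (filterlim_locally _ _) hc (mkposreal 1 Rlt_0_1)). }
  destruct hb as [d hd].
  apply (at_right_intro _ d (cond_pos d)). intros t ht.
  destruct (Taylor_Lagrange f 1 0 t ltac:(lra)) as [z [hz e]].
  { intros s _ k hk. apply hC. exact hk. }
  simpl in e. rewrite h0 in e.
  assert (hz' : Rabs (Derive_n f 2 z) < M).
  { apply hd. change (Rabs (z - 0) < d). rewrite Rminus_0_r, Rabs_pos_eq; lra. }
  change (Derive_n f 2 z) with (Derive (fun x : R => Derive (fun x0 : R => f x0) x) z) in hz'.
  set (D2 := Derive (fun x : R => Derive (fun x0 : R => f x0) x) z) in *.
  change (Derive (fun x : R => f x) 0) with (Derive f 0) in e.
  replace (f t - Derive f 0 * t) with (D2 / 2 * t ^ 2).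
  2:{ rewrite e. field. }
  rewrite Rabs_mult, (Rabs_pos_eq (t ^ 2)) by (apply pow2_ge_0).
  apply Rmult_le_compat_r; [apply pow2_ge_0|].
  unfold Rdiv. rewrite Rabs_mult, (Rabs_pos_eq (/ 2)) by lra.
  pose proof (Rabs_pos D2). lra.
Qed.

(** Let [h] and [e] be the components of [g] normal and parallel to the limiting
    direction.  The velocity is parallel to this direction, so [h] has no linear
    term and [h = O (t^2)], while [r] is comparable with [t].  Hence
    [sin (phi - alpha) = h / r = O (r)]. *)
Lemma C2_arc_contact (lo hi alpha kappa : R) (g : R -> C) (r phi : R -> R) :
  kappa < 1 -> class_C 2 g -> g 0 = 0%C ->
  (Derive (fun s => fst (g s)) 0, Derive (fun s => snd (g s)) 0) <> (0, 0) ->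
  polar_lift lo hi g r phi -> lim0 phi alpha ->
  lim0 (fun t => (phi t - alpha) / Rpower (r t) kappa) 0.
Proof.
  intros hk hC hg0 hv [hp hr] hphi.
  set (x := fun s => fst (g s)) in *. set (y := fun s => snd (g s)) in *.
  assert (hCx : forall n t, (n <= 2)%nat -> ex_derive_n x n t /\ continuous (Derive_n x n) t)
    by (intros n t hn; apply (hC n t hn)).
  assert (hCy : forall n t, (n <= 2)%nat -> ex_derive_n y n t /\ continuous (Derive_n y n) t)
    by (intros n t hn; apply (hC n t hn)).
  assert (hx0 : x 0 = 0) by (unfold x; rewrite hg0; reflexivity).
  assert (hy0 : y 0 = 0) by (unfold y; rewrite hg0; reflexivity).
  destruct (second_order_remainder x hCx hx0) as [Mx hMx].
  destruct (second_order_remainder y hCy hy0) as [My hMy].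
  pose proof (quotient_lim0_Derive x (proj1 (hCx 1%nat 0 ltac:(auto))) hx0) as hx.
  pose proof (quotient_lim0_Derive y (proj1 (hCy 1%nat 0 ltac:(auto))) hy0) as hy.
  set (x' := Derive x 0) in *. set (y' := Derive y 0) in *.
  set (h := fun t => cos alpha * y t - sin alpha * x t).
  set (e := fun t => cos alpha * x t + sin alpha * y t).
  set (h' := cos alpha * y' - sin alpha * x'). set (e' := cos alpha * x' + sin alpha * y').
  assert (tpos : at_right 0 (fun t => 0 < t))
    by (apply (at_right_intro _ 1 Rlt_0_1); intros; lra).
  assert (hh : lim0 (fun t => h t / t) h').
  { refine (lim0_ext _ _ _ _ (lim0_minus _ _ _ _
      (lim0_mult _ _ _ _ (lim0_const (cos alpha)) hy)
      (lim0_mult _ _ _ _ (lim0_const (sin alpha)) hx))).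
    eventually tpos as ht. unfold h. field. lra. }
  assert (hee : lim0 (fun t => e t / t) e').
  { refine (lim0_ext _ _ _ _ (lim0_plus _ _ _ _
      (lim0_mult _ _ _ _ (lim0_const (cos alpha)) hx)
      (lim0_mult _ _ _ _ (lim0_const (sin alpha)) hy))).
    eventually tpos as ht. unfold e. field. lra. }
  assert (hpol : at_right 0 (fun t => 0 < r t /\
    h t = r t * sin (phi t - alpha) /\ e t = r t * cos (phi t - alpha))).
  { eventually hp as [h1 [h2 h3]]. split; [exact h1|].
    unfold h, e, x, y. rewrite h3, sin_minus, cos_minus. simpl. split; ring. }
  assert (hs : lim0 (fun t => sin (phi t - alpha)) 0).
  { replace 0 with (sin (alpha - alpha)) by (rewrite Rminus_diag; apply sin_0).
    apply (lim0_comp phi (fun y => sin (y - alpha))); [exact hphi|apply continuous_sin_shift]. }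
  assert (hc : lim0 (fun t => cos (phi t - alpha)) 1).
  { replace 1 with (cos (alpha - alpha)) by (rewrite Rminus_diag; apply cos_0).
    apply (lim0_comp phi (fun y => cos (y - alpha))); [exact hphi|apply continuous_cos_shift]. }
  assert (hh' : h' = 0).
  { replace h' with (h' * 1) by ring. replace 0 with (e' * 0) by ring.
    apply (lim0_unique (fun t => h t / t * cos (phi t - alpha))).
    - apply lim0_mult; assumption.
    - refine (lim0_ext _ _ _ _ (lim0_mult _ _ _ _ hee hs)).
      eventually hpol as [_ [-> ->]]. unfold Rdiv. ring. }
  assert (he' : e' <> 0).
  { intros he'. apply hv. pose proof (sin2_cos2 alpha) as sc. unfold Rsqr in sc.
    f_equal.
    - transitivity (cos alpha * e' - sin alpha * h'); [|rewrite he', hh'; ring].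
      transitivity (x' * (sin alpha * sin alpha + cos alpha * cos alpha));
        [rewrite sc; ring|unfold e', h'; ring].
    - transitivity (sin alpha * e' + cos alpha * h'); [|rewrite he', hh'; ring].
      transitivity (y' * (sin alpha * sin alpha + cos alpha * cos alpha));
        [rewrite sc; ring|unfold e', h'; ring]. }
  assert (htr : lim0 (fun t => t / r t) (1 / e')).
  { refine (lim0_ext _ _ _ _ (lim0_div _ _ _ _ he' hc hee)).
    assert (hcos := lim0_near _ _ 1 Rlt_0_1 hc).
    eventually (filter_and _ _ tpos (filter_and _ _ hcos hpol)) as [ht [h0 [h1 [_ ->]]]].
    field. repeat split; lra. }
  assert (hbound : at_right 0 (fun t => Rabs (h t / t ^ 2) <= Mx + My)).
  { eventually (filter_and _ _ tpos (filter_and _ _ hMx hMy)) as [ht [hx2 hy2]].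
    replace (h t / t ^ 2) with
      ((cos alpha * (y t - y' * t) - sin alpha * (x t - x' * t)) / t ^ 2).
    2:{ unfold h. replace (cos alpha * (y t - y' * t) - sin alpha * (x t - x' * t))
          with (cos alpha * y t - sin alpha * x t - h' * t) by (unfold h'; ring).
        rewrite hh'. f_equal. ring. }
    assert (ht2 : 0 < t ^ 2) by nra.
    unfold Rdiv. rewrite Rabs_mult, (Rabs_pos_eq (/ _)) by (apply Rlt_le, Rinv_0_lt_compat, ht2).
    apply (Rmult_le_reg_r (t ^ 2)); [exact ht2|].
    rewrite Rmult_assoc, Rinv_l, Rmult_1_r by lra.
    assert (sa : Rabs (sin alpha) <= 1) by (apply Rabs_le, SIN_bound).
    assert (ca : Rabs (cos alpha) <= 1) by (apply Rabs_le, COS_bound).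
    eapply Rle_trans; [apply Rabs_triang|]. rewrite Rabs_Ropp, !Rabs_mult.
    pose proof (Rabs_pos (y t - y' * t)). pose proof (Rabs_pos (x t - x' * t)).
    nra. }
  assert (rpos : at_right 0 (fun t => 0 < r t)) by (eventually hp as h1; apply h1).
  assert (hsr : lim0 (fun t => sin (phi t - alpha) / Rpower (r t) kappa) 0).
  { assert (hq : lim0 (fun t => (t / r t * (t / r t)) * Rpower (r t) (1 - kappa)) 0).
    { replace 0 with (1 / e' * (1 / e') * 0) by ring.
      apply lim0_mult; [now apply lim0_mult|].
      apply lim0_Rpower; [lra|exact rpos|exact hr]. }
    refine (lim0_ext _ _ _ _ (lim0_bounded_mult _ _ _ hbound hq)).
    eventually (filter_and _ _ tpos hpol) as [ht [h1 [-> _]]].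
    unfold Rminus at 2. rewrite Rpower_plus, Rpower_1, Rpower_Ropp by exact h1.
    assert (0 < Rpower (r t) kappa) by apply exp_pos.
    field. repeat split; lra. }
  destruct Rabs_le_twice_sin as [d [hd0 hd]].
  apply (lim0_squeeze _ (fun t => 2 * Rabs (sin (phi t - alpha) / Rpower (r t) kappa))).
  - eventually (proj1 (lim0_iff _ _) hphi d hd0) as ht. apply hd in ht.
    unfold Rdiv. rewrite !Rabs_mult, <- Rmult_assoc.
    apply Rmult_le_compat_r; [apply Rabs_pos|exact ht].
  - replace 0 with (2 * Rabs 0) by (rewrite Rabs_R0; ring).
    apply lim0_mult; [apply lim0_const|].
    apply (lim0_comp _ Rabs); [exact hsr|apply continuous_Rabs].
Qed.

Lemma tangent_contact_lift (D : C -> Prop) (lo hi alpha kappa : R) (g : R -> C) (r phi : R -> R) :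
  hi - lo < 2 * PI -> smooth_jordan_arc D g -> polar_lift lo hi g r phi -> lim0 phi alpha ->
  tangent_contact lo hi g alpha kappa ->
  lim0 (fun t => (phi t - alpha) / Rpower (r t) kappa) 0.
Proof.
  intros hw [_ [hv [_ [h0 _]]]] hl hphi [[hk hC]|ho].
  - apply (C2_arc_contact lo hi alpha kappa g r phi); try assumption. apply hv. lra.
  - exact (osculates_ray_contact _ _ _ _ _ _ _ hw hl ho).
Qed.

(** Contact with the critical ray makes the linear term negligible against
    [r^{1/beta}]. *)
Lemma contact_sin_quotient (r phi : R -> R) (phi0 beta : R) :
  0 < beta -> at_right 0 (fun t => 0 < r t) ->
  lim0 (fun t => (phi t - phi0) / Rpower (r t) (1 / beta - 1)) 0 ->
  lim0 (fun t => r t / Rpower (r t) (1 / beta) * sin (phi t - phi0)) 0.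
Proof.
  intros hb hpos h.
  apply (lim0_squeeze _ (fun t => Rabs ((phi t - phi0) / Rpower (r t) (1 / beta - 1)))).
  - eventually hpos as ht. rewrite <- Rpower_ratio, (Rpower_1 (r t)) by exact ht.
    assert (hp : 0 < Rpower (r t) (1 / beta)) by apply exp_pos.
    set (p := Rpower (r t) (1 / beta)) in *.
    replace ((phi t - phi0) / (p / r t)) with (r t / p * (phi t - phi0)) by (field; lra).
    rewrite !Rabs_mult. apply Rmult_le_compat_l; [apply Rabs_pos|apply Rabs_sin_le].
  - replace 0 with (Rabs 0) by apply Rabs_R0.
    apply (lim0_comp _ Rabs); [exact h|apply continuous_Rabs].
Qed.

(** In the directions of the sides [cos (phi / beta)] has a simple zero, and the
    contact hypothesis makes the power term negligible against [r]. *)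
Lemma contact_cos_quotient (r phi : R -> R) (phi0 beta : R) :
  0 < beta -> cos (phi0 / beta) = 0 -> at_right 0 (fun t => 0 < r t) ->
  lim0 (fun t => (phi t - phi0) / Rpower (r t) (1 - 1 / beta)) 0 ->
  lim0 (fun t => Rpower (r t) (1 / beta) / r t * cos (phi t / beta)) 0.
Proof.
  intros hb hc hpos h.
  apply (lim0_squeeze _ (fun t => / beta * Rabs ((phi t - phi0) / Rpower (r t) (1 - 1 / beta)))).
  - eventually hpos as ht. rewrite <- Rpower_ratio, (Rpower_1 (r t)) by exact ht.
    assert (hp : 0 < Rpower (r t) (1 / beta)) by apply exp_pos.
    set (p := Rpower (r t) (1 / beta)) in *.
    replace ((phi t - phi0) / (r t / p)) with (p / r t * (phi t - phi0)) by (field; lra).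
    rewrite !Rabs_mult.
    assert (hcos : Rabs (cos (phi t / beta)) <= / beta * Rabs (phi t - phi0)).
    { replace (phi t / beta) with (phi0 / beta + (phi t - phi0) / beta) by (field; lra).
      rewrite cos_plus, hc, Rmult_0_l, Rminus_0_l, Rabs_Ropp, Rabs_mult.
      pose proof (Rabs_sin_le_1 (phi0 / beta)) as k1.
      pose proof (Rabs_sin_le ((phi t - phi0) / beta)) as k2.
      unfold Rdiv at 2 in k2. rewrite Rabs_mult, (Rabs_pos_eq (/ beta)) in k2
        by (apply Rlt_le, Rinv_0_lt_compat, hb).
      pose proof (Rabs_pos (sin ((phi t - phi0) / beta))).
      pose proof (Rabs_pos (sin (phi0 / beta))). nra. }
    pose proof (Rabs_pos (p / r t)) as k. pose proof (Rmult_le_compat_l _ _ _ k hcos). lra.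
  - replace 0 with (/ beta * Rabs 0) by (rewrite Rabs_R0; ring).
    apply lim0_mult; [apply lim0_const|].
    apply (lim0_comp _ Rabs); [exact h|apply continuous_Rabs].
Qed.

(** The hypotheses on [x0] say that it is a multiple of [PI]. *)
Lemma lim0_contact_sin (x rho : R -> R) (x0 q : R) :
  sin x0 = 0 -> cos x0 * cos x0 = 1 ->
  lim0 (fun t => (x t - x0) / Rpower (rho t) q) 0 ->
  lim0 (fun t => sin (x t) / Rpower (rho t) q) 0.
Proof.
  intros hs hc h. apply (lim0_squeeze _ (fun t => Rabs ((x t - x0) / Rpower (rho t) q))).
  - apply (filter_forall (F := at_right 0)). intros t.
    unfold Rdiv. rewrite !Rabs_mult. apply Rmult_le_compat_r; [apply Rabs_pos|].
    replace (sin (x t)) with (cos x0 * sin (x t - x0)).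
    2:{ rewrite sin_minus, hs. transitivity (cos x0 * cos x0 * sin (x t)); [ring|rewrite hc; ring]. }
    rewrite Rabs_mult. pose proof (Rabs_cos_le_1 x0). pose proof (Rabs_sin_le (x t - x0)).
    pose proof (Rabs_pos (cos x0)). pose proof (Rabs_pos (sin (x t - x0))). nra.
  - replace 0 with (Rabs 0) by apply Rabs_R0.
    apply (lim0_comp _ Rabs); [exact h|apply continuous_Rabs].
Qed.

(** * The constants of the corner *)

(** The radicand is [(sp - sm)^2 + 2 sp sm (1 + cos (PI beta))]. *)
Lemma mu_pos (beta sp sm : R) :
  0 < beta < 2 -> beta <> 1 -> 0 < sp -> 0 < sm -> 0 < mu beta sp sm.
Proof.
  intros hb hb1 hsp hsm. pose proof PI_RGT_0 as hpi.
  assert (hs : sin (PI * beta) <> 0).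
  { intros h. destruct (Rlt_dec beta 1) as [h1|h1].
    - pose proof (sin_gt_0 (PI * beta)). nra.
    - assert (0 < beta - 1 < 1) by lra.
      pose proof (sin_gt_0 (PI * (beta - 1))) as h2.
      replace (PI * (beta - 1)) with (PI * beta - PI) in h2 by ring.
      rewrite sin_minus, sin_PI, cos_PI in h2. nra. }
  unfold mu. apply Rmult_lt_0_compat; [now apply Rinv_0_lt_compat, Rabs_pos_lt|].
  apply sqrt_lt_R0.
  assert (hc : -1 < cos (PI * beta)).
  { pose proof (sin2_cos2 (PI * beta)) as e. unfold Rsqr in e.
    pose proof (Rsqr_pos_lt _ hs) as h. unfold Rsqr in h. nra. }
  assert (hprod : 0 < sp * sm * (1 + cos (PI * beta))) by (repeat apply Rmult_lt_0_compat; lra).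
  pose proof (pow2_ge_0 (sp - sm)). nra.
Qed.

(** The factor [(sp - sm) / (sp + sm)] has modulus less than one, so
    [phi_star] is smaller in modulus than the acute angle whose tangent is
    [Rabs (tan (PI * beta / 2))]; this is [PI * beta / 2] for [beta < 1] and its
    supplement for [beta > 1].  The second bound keeps [phi - phi_star] inside
    [(- PI, PI)] throughout the sector, where the sign of its sine is known. *)
Lemma phi_star_bounds (beta sp sm : R) :
  0 < beta < 2 -> beta <> 1 -> 0 < sp -> 0 < sm ->
  Rabs (phi_star beta sp sm) < PI * beta / 2 /\
  Rabs (phi_star beta sp sm) < PI - PI * beta / 2.
Proof.
  intros hb hb1 hsp hsm. pose proof PI_RGT_0 as hpi. unfold phi_star.
  set (k := (sp - sm) / (sp + sm)).
  assert (hk : -1 < k < 1).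
  { assert (e : k * (sp + sm) = sp - sm) by (unfold k; field; lra). split; nra. }
  assert (key : forall c, 0 < c < PI / 2 -> forall j, -1 < j < 1 ->
    Rabs (atan (j * tan c)) < c).
  { intros c hc j hj. assert (ht : 0 < tan c) by (apply tan_gt_0; lra).
    apply Rabs_def1.
    - rewrite <- (atan_tan c) at 2 by lra. apply atan_increasing. nra.
    - rewrite <- (atan_tan c) at 1 by lra. rewrite <- atan_opp. apply atan_increasing. nra. }
  destruct (Rlt_dec beta 1) as [h1|h1].
  - assert (h : Rabs (atan (k * tan (PI * beta / 2))) < PI * beta / 2).
    { apply key; [split; nra|exact hk]. }
    split; [exact h|]. nra.
  - assert (hc : 0 < PI - PI * beta / 2 < PI / 2) by (split; nra).
    assert (e : k * tan (PI * beta / 2) = (- k) * tan (PI - PI * beta / 2)).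
    { rewrite Rtrigo_facts.tan_pi_minus; [ring|].
      pose proof (cos_gt_0 (PI - PI * beta / 2)) as h.
      rewrite cos_minus, cos_PI, sin_PI in h. lra. }
    rewrite e.
    assert (h : Rabs (atan (- k * tan (PI - PI * beta / 2))) < PI - PI * beta / 2).
    { apply key; [exact hc|lra]. }
    split; [|exact h]. lra.
Qed.

Lemma theta_star_polar (a1 b1 : R) :
  a1 <> 0 -> 0 < b1 ->
  0 < theta_star a1 b1 < PI /\
  exists R0, 0 < R0 /\ a1 = R0 * cos (theta_star a1 b1) /\ b1 = R0 * sin (theta_star a1 b1).
Proof.
  intros ha hb. unfold theta_star. pose proof (atan_bound (b1 / a1)) as hat.
  assert (hcos : 0 < cos (atan (b1 / a1))) by (apply cos_gt_0; lra).
  assert (htan : sin (atan (b1 / a1)) = b1 / a1 * cos (atan (b1 / a1))).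
  { rewrite <- (tan_atan (b1 / a1)) at 2. unfold tan. field. lra. }
  destruct (Rlt_dec 0 a1) as [h|h].
  - assert (hq : 0 < b1 / a1) by (apply Rdiv_lt_0_compat; lra).
    apply atan_increasing in hq. rewrite atan_0 in hq.
    split; [lra|]. exists (a1 / cos (atan (b1 / a1))). repeat split.
    + apply Rdiv_lt_0_compat; lra.
    + field. lra.
    + rewrite htan. field. lra.
  - assert (hq : b1 / a1 < 0) by (apply Rdiv_pos_neg; lra).
    apply atan_increasing in hq. rewrite atan_0 in hq.
    split; [lra|]. exists (- a1 / cos (atan (b1 / a1))). repeat split.
    + apply Rdiv_lt_0_compat; lra.
    + rewrite cos_plus, cos_PI, sin_PI. field. lra.
    + rewrite sin_plus, cos_PI, sin_PI, htan. field. lra.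
Qed.

(** * Asymptotics of the map along an arc *)

(** The consequences of the expansion that matter along an arc: the remainders
    are negligible on the scale [r] and on the scale [r^{1/beta}].  The same
    record serves direct images and preimages, since it only speaks of [r],
    [phi] and the two components of the image. *)
Record corner_asymptotics (beta m phis a b : R) (r phi u v : R -> R) : Prop := {
  ca_pos : at_right 0 (fun t => 0 < r t);
  ca_vertex : lim0 r 0;
  ca_range : at_right 0 (fun t => - (PI * beta / 2) <= phi t <= PI * beta / 2);
  ca_u_r : lim0 (fun t => (u t + m * r t * sin (phi t - phis)
                  - a * (Rpower (r t) (1 / beta) * cos (phi t / beta))) / r t) 0;
  ca_u_p : lim0 (fun t => (u t + m * r t * sin (phi t - phis)
                  - a * (Rpower (r t) (1 / beta) * cos (phi t / beta)))
                  / Rpower (r t) (1 / beta)) 0;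
  ca_v_r : lim0 (fun t => (v t
                  - b * (Rpower (r t) (1 / beta) * cos (phi t / beta))) / r t) 0;
  ca_v_p : lim0 (fun t => (v t
                  - b * (Rpower (r t) (1 / beta) * cos (phi t / beta)))
                  / Rpower (r t) (1 / beta)) 0 }.

(** The remainder is [O (r^{2/beta})] with [2 / beta > 1], hence [o (r)], and it
    is the square of [r^{1/beta}], hence [o (r^{1/beta})]. *)
Lemma corner_asymptotics_of_expansion (beta sp sm a b : R) (F : C -> C)
    (g : R -> C) (r phi : R -> R) :
  0 < beta < 2 -> corner_expansion beta sp sm a b F ->
  polar_lift (- (PI * beta / 2)) (PI * beta / 2) g r phi ->
  corner_asymptotics beta (mu beta sp sm) (phi_star beta sp sm) a b r phi
    (fun t => fst (F (g t))) (fun t => snd (F (g t))).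
Proof.
  intros hb [K [d [hd hexp]]] [hp hr].
  assert (hpos : at_right 0 (fun t => 0 < r t)) by (eventually hp as h; apply h).
  assert (hK : at_right 0 (fun t =>
    0 < r t /\
    Rabs (fst (F (g t)) + mu beta sp sm * r t * sin (phi t - phi_star beta sp sm)
        - a * (Rpower (r t) (1 / beta) * cos (phi t / beta)))
      <= K * Rpower (r t) (2 / beta) /\
    Rabs (snd (F (g t)) - b * (Rpower (r t) (1 / beta) * cos (phi t / beta)))
      <= K * Rpower (r t) (2 / beta))).
  { eventually (filter_and _ _ hp (lim0_near _ _ d hd hr)) as [[h1 [h2 h3]] h4].
    specialize (hexp (r t) (phi t) ltac:(lra) h2). rewrite <- h3 in hexp.
    split; [exact h1|].
    destruct (F (g t)) as [u v].
    match type of hexp with Cmod ?z <= _ => pose proof (Rmax_Cmod z) as hm;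
      set (z0 := z) in * end.
    assert (e1 : fst z0 = u + mu beta sp sm * r t * sin (phi t - phi_star beta sp sm)
        - a * (Rpower (r t) (1 / beta) * cos (phi t / beta))) by (unfold z0; simpl; ring).
    assert (e2 : snd z0 = v - b * (Rpower (r t) (1 / beta) * cos (phi t / beta)))
      by (unfold z0; simpl; ring).
    simpl fst. simpl snd. rewrite <- e1, <- e2.
    pose proof (Rmax_l (Rabs (fst z0)) (Rabs (snd z0))).
    pose proof (Rmax_r (Rabs (fst z0)) (Rabs (snd z0))). lra. }
  assert (key : forall (E s : R -> R) (q : R), 0 < 2 / beta - q ->
     (forall t, s t = Rpower (r t) q) ->
     at_right 0 (fun t => 0 < r t /\ Rabs (E t) <= K * Rpower (r t) (2 / beta)) ->
     lim0 (fun t => E t / s t) 0).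
  { intros E s q hq hs hE.
    apply (lim0_squeeze _ (fun t => K * Rpower (r t) (2 / beta - q))).
    - eventually hE as [h1 h2]. rewrite hs.
      assert (hpw : 0 < Rpower (r t) q) by apply exp_pos.
      unfold Rminus, Rdiv at 1.
      rewrite Rabs_mult, (Rabs_pos_eq (/ _)) by (apply Rlt_le, Rinv_0_lt_compat, hpw).
      rewrite Rpower_plus, Rpower_Ropp, <- Rmult_assoc.
      apply Rmult_le_compat_r; [apply Rlt_le, Rinv_0_lt_compat, hpw|exact h2].
    - replace 0 with (K * 0) by ring. apply lim0_mult; [apply lim0_const|].
      now apply lim0_Rpower. }
  assert (q1 : 0 < 2 / beta - 1).
  { apply (Rmult_lt_reg_r beta); [lra|]. rewrite Rmult_minus_distr_r.
    unfold Rdiv. rewrite Rmult_assoc, Rinv_l by lra. lra. }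
  assert (q2 : 0 < 2 / beta - 1 / beta).
  { replace (2 / beta - 1 / beta) with (/ beta) by (field; lra).
    apply Rinv_0_lt_compat; lra. }
  assert (quot : forall E : R -> R,
    at_right 0 (fun t => 0 < r t /\ Rabs (E t) <= K * Rpower (r t) (2 / beta)) ->
    lim0 (fun t => E t / r t) 0).
  { intros E hE. refine (lim0_ext _ _ _ _ (key E _ 1 q1 (fun t => eq_refl) hE)).
    eventually hpos as h. rewrite Rpower_1 by exact h. reflexivity. }
  constructor; [exact hpos|exact hr| | | | |].
  - eventually hp as h. apply h.
  - apply quot. eventually hK as h. tauto.
  - apply (key _ _ (1 / beta) q2); [reflexivity|]. eventually hK as h. tauto.
  - apply quot. eventually hK as h. tauto.
  - apply (key _ _ (1 / beta) q2); [reflexivity|]. eventually hK as h. tauto.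
Qed.

Lemma corner_limit_linear_scale (beta m phis a b phi0 : R) (r phi u v : R -> R) :
  corner_asymptotics beta m phis a b r phi u v -> lim0 phi phi0 ->
  lim0 (fun t => Rpower (r t) (1 / beta) / r t * cos (phi t / beta)) 0 ->
  lim0 (fun t => u t / r t) (- m * sin (phi0 - phis)) /\ lim0 (fun t => v t / r t) 0.
Proof.
  intros hA hphi hpc. pose proof (ca_pos _ _ _ _ _ _ _ _ _ hA) as hpos. split.
  - replace (- m * sin (phi0 - phis)) with (0 + - m * sin (phi0 - phis) + a * 0) by ring.
    refine (lim0_ext _ _ _ _ (lim0_plus _ _ _ _ (lim0_plus _ _ _ _
      (ca_u_r _ _ _ _ _ _ _ _ _ hA)
      (lim0_mult _ _ _ _ (lim0_const (- m)) (lim0_sin_shift _ _ phis hphi)))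
      (lim0_mult _ _ _ _ (lim0_const a) hpc))).
    eventually hpos as h. field. lra.
  - replace 0 with (0 + b * 0) by ring.
    refine (lim0_ext _ _ _ _ (lim0_plus _ _ _ _ (ca_v_r _ _ _ _ _ _ _ _ _ hA)
      (lim0_mult _ _ _ _ (lim0_const b) hpc))).
    eventually hpos as h. field. lra.
Qed.

Lemma corner_limit_power_scale (beta m phis a b phi0 : R) (r phi u v : R -> R) :
  corner_asymptotics beta m phis a b r phi u v -> lim0 phi phi0 ->
  lim0 (fun t => r t / Rpower (r t) (1 / beta) * sin (phi t - phis)) 0 ->
  lim0 (fun t => u t / Rpower (r t) (1 / beta)) (a * cos (phi0 / beta)) /\
  lim0 (fun t => v t / Rpower (r t) (1 / beta)) (b * cos (phi0 / beta)).
Proof.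
  intros hA hphi hrs. split.
  - replace (a * cos (phi0 / beta)) with (0 + a * cos (phi0 / beta) + - m * 0) by ring.
    refine (lim0_ext _ _ _ _ (lim0_plus _ _ _ _ (lim0_plus _ _ _ _
      (ca_u_p _ _ _ _ _ _ _ _ _ hA)
      (lim0_mult _ _ _ _ (lim0_const a) (lim0_cos_scaled _ _ beta hphi)))
      (lim0_mult _ _ _ _ (lim0_const (- m)) hrs))).
    apply (filter_forall (F := at_right 0)). intros t.
    assert (h : 0 < Rpower (r t) (1 / beta)) by apply exp_pos.
    set (p := Rpower (r t) (1 / beta)) in *. field_simplify; [reflexivity|lra|lra].
  - replace (b * cos (phi0 / beta)) with (0 + b * cos (phi0 / beta)) by ring.
    refine (lim0_ext _ _ _ _ (lim0_plus _ _ _ _ (ca_v_p _ _ _ _ _ _ _ _ _ hA)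
      (lim0_mult _ _ _ _ (lim0_const b) (lim0_cos_scaled _ _ beta hphi)))).
    apply (filter_forall (F := at_right 0)). intros t.
    assert (h : 0 < Rpower (r t) (1 / beta)) by apply exp_pos.
    set (p := Rpower (r t) (1 / beta)) in *. field_simplify; [reflexivity|lra|lra].
Qed.

(** * Directions of images *)

Lemma image_in_upper_half_plane (beta Rad sp sm : R) (H : C -> Prop) (F : C -> C)
    (g : R -> C) (r phi : R -> R) :
  0 < Rad -> (forall w, H w -> 0 < snd w) ->
  (forall z, sector beta Rad z -> H (F z)) ->
  (forall s, 0 < s < Rad -> F (polar s (PI * beta / 2)) = (- (sm * s), 0)) ->
  (forall s, 0 < s < Rad -> F (polar s (- (PI * beta / 2))) = (sp * s, 0)) ->
  polar_lift (- (PI * beta / 2)) (PI * beta / 2) g r phi ->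
  at_right 0 (fun t => 0 <= snd (F (g t))).
Proof.
  intros hRad hH hF hm hp [hl hr].
  eventually (filter_and _ _ hl (lim0_near _ _ _ hRad hr)) as [[h1 [h2 ->]] h3].
  destruct (Req_dec (phi t) (PI * beta / 2)) as [-> |n1].
  { rewrite hm by lra. simpl. lra. }
  destruct (Req_dec (phi t) (- (PI * beta / 2))) as [-> |n2].
  { rewrite hp by lra. simpl. lra. }
  apply Rlt_le, hH, hF. exists (r t), (phi t). repeat split; lra.
Qed.

(** The factor [cos theta] is [1] on the positive half of the segment and [-1] on
    the negative half, which treats the two halves together. *)
Lemma image_leaves_along_segment (beta m phis a b phi0 theta : R) (r phi : R -> R) (w : R -> C) :
  corner_asymptotics beta m phis a b r phi (fun t => fst (w t)) (fun t => snd (w t)) ->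
  at_right 0 (fun t => 0 <= snd (w t)) -> lim0 phi phi0 -> 0 < m ->
  lim0 (fun t => Rpower (r t) (1 / beta) / r t * cos (phi t / beta)) 0 ->
  theta = 0 \/ theta = PI -> cos theta * sin (phi0 - phis) < 0 ->
  leaves_at_angle 0 PI w theta.
Proof.
  intros hA hup hphi hm hpc hth hs. pose proof PI_RGT_0 as hpi.
  destruct (corner_limit_linear_scale _ _ _ _ _ _ _ _ _ _ hA hphi hpc) as [hu hv].
  assert (hct : cos theta * cos theta = 1 /\ sin theta = 0).
  { destruct hth as [-> | ->]; rewrite ?cos_0, ?sin_0, ?cos_PI, ?sin_PI; lra. }
  destruct hct as [hct hst].
  apply (leaves_at_angle_of_direction w r (- m * sin (phi0 - phis) * cos theta)).
  - nra.
  - destruct hth; lra.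
  - apply (ca_pos _ _ _ _ _ _ _ _ _ hA).
  - apply (ca_vertex _ _ _ _ _ _ _ _ _ hA).
  - exact hup.
  - rewrite Rmult_assoc, hct, Rmult_1_r. exact hu.
  - rewrite hst, Rmult_0_r. exact hv.
Qed.

Lemma image_leaves_transversally (beta m phis R0 thetas phi0 : R) (r phi : R -> R) (w : R -> C) :
  corner_asymptotics beta m phis (R0 * cos thetas) (R0 * sin thetas) r phi
    (fun t => fst (w t)) (fun t => snd (w t)) ->
  at_right 0 (fun t => 0 <= snd (w t)) -> lim0 phi phi0 ->
  0 < beta -> 0 < R0 -> 0 <= thetas <= PI -> 0 < cos (phi0 / beta) ->
  lim0 (fun t => r t / Rpower (r t) (1 / beta) * sin (phi t - phis)) 0 ->
  leaves_at_angle 0 PI w thetas.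
Proof.
  intros hA hup hphi hb hR hth hc hrs.
  destruct (corner_limit_power_scale _ _ _ _ _ _ _ _ _ _ hA hphi hrs) as [hu hv].
  apply (leaves_at_angle_of_direction w (fun t => Rpower (r t) (1 / beta))
    (R0 * cos (phi0 / beta))).
  - now apply Rmult_lt_0_compat.
  - exact hth.
  - apply (filter_forall (F := at_right 0)). intros t. apply exp_pos.
  - apply lim0_Rpower.
    + apply Rdiv_lt_0_compat; lra.
    + apply (ca_pos _ _ _ _ _ _ _ _ _ hA).
    + apply (ca_vertex _ _ _ _ _ _ _ _ _ hA).
  - exact hup.
  - replace (R0 * cos (phi0 / beta) * cos thetas)
      with (R0 * cos thetas * cos (phi0 / beta)) by ring. exact hu.
  - replace (R0 * cos (phi0 / beta) * sin thetas)
      with (R0 * sin thetas * cos (phi0 / beta)) by ring. exact hv.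
Qed.

(** * Directions of preimages *)

(** Near the origin the closed upper half-plane is contained in the domain of
    the local inverse, which is continuous there and fixes the origin; so the
    preimage of the arc tends to the vertex inside the closed sector. *)
Lemma preimage_lift (beta Rad sp sm lp lm : R) (H : C -> Prop) (F Finv : C -> C)
    (Lam : R -> C) (rho theta : R -> R) :
  0 < beta -> 0 < sp -> 0 < sm -> 0 < lp -> 0 < lm -> upper_part H lm lp ->
  (forall z, sector beta Rad z -> H (F z)) -> F 0%C = 0%C ->
  (forall s, 0 < s < Rad -> F (polar s (PI * beta / 2)) = (- (sm * s), 0)) ->
  (forall s, 0 < s < Rad -> F (polar s (- (PI * beta / 2))) = (sp * s, 0)) ->
  inverse_near_0 (set_union (sector beta Rad) (corner_contour beta Rad))
    (set_union H (segment lm lp)) F Finv ->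
  polar_lift 0 PI Lam rho theta ->
  at_right 0 (fun t => F (Finv (Lam t)) = Lam t) /\
  exists r phi,
    polar_lift (- (PI * beta / 2)) (PI * beta / 2) (fun t => Finv (Lam t)) r phi.
Proof.
  intros hb hsp hsm hlp hlm [_ [hHup hHnear]] hF hF0 hFm hFp [rho0 [hrho0 [hinv hcont]]] hl.
  pose proof PI_RGT_0 as hpi.
  assert (hseg0 : segment lm lp 0%C) by (split; simpl; lra).
  assert (hpolar : forall z, set_union (sector beta Rad) (corner_contour beta Rad) z ->
    z = 0%C \/ exists r phi, polar_point (- (PI * beta / 2)) (PI * beta / 2) z r phi).
  { assert (0 < PI * beta) by nra.
    intros z [[r [phi [h1 [h2 h3]]]]|[[r [h1 h3]]|[h3|[r [h1 h3]]]]]; [right|right|left|right].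
    - exists r, phi. repeat split; lra || assumption.
    - exists r, (PI * beta / 2). repeat split; lra || assumption.
    - exact h3.
    - exists r, (- (PI * beta / 2)). repeat split; lra || assumption. }
  (* only the vertex is sent to the origin, so [Finv] fixes it *)
  assert (hFinv0 : Finv 0%C = 0%C).
  { destruct (hinv 0%C) as [h1 h2]; [now right|rewrite Cmod_0; exact hrho0|].
    destruct h1 as [h1|[[r [h1 h3]]|[h3|[r [h1 h3]]]]].
    - apply hF, hHup in h1. rewrite h2 in h1. simpl in h1. lra.
    - rewrite h3, hFm in h2 by exact h1. injection h2 as h2. nra.
    - exact h3.
    - rewrite h3, hFp in h2 by exact h1. injection h2 as h2. nra. }
  pose proof (polar_lift_tends_to_vertex _ _ _ _ _ hl) as hLam.
  assert (hB : at_right 0 (fun t =>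
    set_union H (segment lm lp) (Lam t) /\ Cmod (Lam t) < rho0 /\ Lam t <> 0%C)).
  { assert (hmin : 0 < Rmin lm lp) by now apply Rmin_glb_lt.
    pose proof (hLam _ (hHnear 0%C hseg0)) as hnear. unfold filtermap in hnear.
    eventually (filter_and _ _ hnear (filter_and _ _ (lift_point _ _ _ _ _ hl)
      (filter_and _ _ (lim0_near _ _ _ hrho0 (lift_radius _ _ _ _ _ hl))
         (lim0_near _ _ _ hmin (lift_radius _ _ _ _ _ hl))))) as [h0 [[h1 [h2 h3]] [h4 h5]]].
    rewrite h3 in h0 |- *. pose proof (Rmin_l lm lp). pose proof (Rmin_r lm lp).
    split; [|split].
    - destruct (Rlt_dec 0 (snd (polar (rho t) (theta t)))) as [h|h]; [left; exact (h0 h)|].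
      right. simpl in h.
      assert (hs : 0 <= sin (theta t)) by (apply sin_ge_0; lra).
      pose proof (COS_bound (theta t)). split; simpl; nra.
    - rewrite Cmod_polar; lra.
    - intros hz. assert (e : Cmod (polar (rho t) (theta t)) = 0) by (rewrite hz; apply Cmod_0).
      rewrite Cmod_polar in e; lra. }
  assert (hA : at_right 0 (fun t => Lam t <> 0%C /\ F (Finv (Lam t)) = Lam t /\
    set_union (sector beta Rad) (corner_contour beta Rad) (Finv (Lam t)))).
  { eventually hB as [h1 [h2 h3]]. destruct (hinv _ h1 h2) as [h4 h5]. tauto. }
  split; [eventually hA as h; apply h|].
  apply polar_lift_exists. intros eps he.
  assert (he2 : 0 < eps / 2) by lra.
  assert (hsmall : at_right 0 (fun t => ball (0%C : C) (eps / 2) (Finv (Lam t)))).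
  { assert (h0 : set_union H (segment lm lp) 0%C /\ Cmod 0%C < rho0)
      by (split; [now right|rewrite Cmod_0; exact hrho0]).
    pose proof (hcont 0%C h0) as hc. rewrite hFinv0 in hc.
    pose proof (hLam _ (hc _ (locally_ball _ (mkposreal _ he2)))) as h.
    unfold filtermap in h.
    eventually (filter_and _ _ hB h) as [[h1 [h2 _]] h3]. apply h3. tauto. }
  eventually (filter_and _ _ hA hsmall) as [[h1 [h2 h3]] h4].
  destruct (hpolar _ h3) as [h5|[r [phi hp]]].
  - exfalso. apply h1. rewrite <- h2, h5. exact hF0.
  - exists r, phi. split; [|exact hp]. destruct hp as [p1 [p2 p3]].
    rewrite p3 in h4. pose proof (polar_near_vertex r phi (mkposreal _ he2) p1 h4) as h6.
    simpl in h6. lra.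
Qed.

(** The combination [u sin theta - v cos theta] vanishes because [theta] is the
    polar angle of the image point; this eliminates the unknown radius. *)
Lemma cross_linear_scale (beta m phis a b : R) (r phi u v theta : R -> R) :
  corner_asymptotics beta m phis a b r phi u v ->
  at_right 0 (fun t => u t * sin (theta t) = v t * cos (theta t)) ->
  lim0 (fun t => m * sin (phi t - phis) * sin (theta t)
    - Rpower (r t) (1 / beta) / r t *
        (cos (phi t / beta) * (a * sin (theta t) - b * cos (theta t)))) 0.
Proof.
  intros hA hx.
  assert (h1 := lim0_bounded_mult (fun t => sin (theta t)) _ 1
    (filter_forall (F := at_right 0) _ (fun t => Rabs_sin_le_1 (theta t)))
    (ca_u_r _ _ _ _ _ _ _ _ _ hA)).
  assert (h2 := lim0_bounded_mult (fun t => cos (theta t)) _ 1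
    (filter_forall (F := at_right 0) _ (fun t => Rabs_cos_le_1 (theta t)))
    (ca_v_r _ _ _ _ _ _ _ _ _ hA)).
  replace 0 with (0 - 0) by ring. refine (lim0_ext _ _ _ _ (lim0_minus _ _ _ _ h1 h2)).
  eventually (filter_and _ _ hx (ca_pos _ _ _ _ _ _ _ _ _ hA)) as [e h].
  set (p := Rpower (r t) (1 / beta)).
  apply (Rmult_eq_reg_r (r t)); [|lra]. field_simplify; lra.
Qed.

Lemma cross_power_scale (beta m phis a b : R) (r phi u v theta : R -> R) :
  corner_asymptotics beta m phis a b r phi u v ->
  at_right 0 (fun t => u t * sin (theta t) = v t * cos (theta t)) ->
  lim0 (fun t => r t / Rpower (r t) (1 / beta) * (m * sin (phi t - phis) * sin (theta t))
    - cos (phi t / beta) * (a * sin (theta t) - b * cos (theta t))) 0.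
Proof.
  intros hA hx.
  assert (h1 := lim0_bounded_mult (fun t => sin (theta t)) _ 1
    (filter_forall (F := at_right 0) _ (fun t => Rabs_sin_le_1 (theta t)))
    (ca_u_p _ _ _ _ _ _ _ _ _ hA)).
  assert (h2 := lim0_bounded_mult (fun t => cos (theta t)) _ 1
    (filter_forall (F := at_right 0) _ (fun t => Rabs_cos_le_1 (theta t)))
    (ca_v_p _ _ _ _ _ _ _ _ _ hA)).
  replace 0 with (0 - 0) by ring. refine (lim0_ext _ _ _ _ (lim0_minus _ _ _ _ h1 h2)).
  eventually hx as e.
  assert (hp : 0 < Rpower (r t) (1 / beta)) by apply exp_pos.
  set (p := Rpower (r t) (1 / beta)) in *.
  apply (Rmult_eq_reg_r p); [|lra]. field_simplify; lra.
Qed.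

(** Used with [s = r] when [beta < 1] and with [s = r^{1/beta}] when
    [beta > 1]: the larger of the two scales bounds the radius of the image. *)
Lemma image_radius_bound (beta m phis a b : R) (r phi u v rho theta s : R -> R) :
  at_right 0 (fun t => 0 < rho t /\ u t = rho t * cos (theta t) /\ v t = rho t * sin (theta t)) ->
  at_right 0 (fun t => 0 < r t <= s t) ->
  at_right 0 (fun t => Rpower (r t) (1 / beta) <= s t) ->
  lim0 (fun t => (u t + m * r t * sin (phi t - phis)
                  - a * (Rpower (r t) (1 / beta) * cos (phi t / beta))) / s t) 0 ->
  lim0 (fun t => (v t - b * (Rpower (r t) (1 / beta) * cos (phi t / beta))) / s t) 0 ->
  at_right 0 (fun t => 0 < rho t <= (Rabs m + Rabs a + Rabs b + 2) * s t).
Proof.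
  intros hpol hr hp hu hv.
  assert (hu1 := proj1 (lim0_iff _ _) hu 1 Rlt_0_1).
  assert (hv1 := proj1 (lim0_iff _ _) hv 1 Rlt_0_1).
  eventually (filter_and _ _ (filter_and _ _ hpol (filter_and _ _ hr hp)) (filter_and _ _ hu1 hv1))
    as [[[h1 [h2 h3]] [h4 h5]] [h6 h7]].
  split; [exact h1|].
  assert (hs : 0 < s t) by lra.
  assert (hpp : 0 < Rpower (r t) (1 / beta)) by apply exp_pos.
  set (p := Rpower (r t) (1 / beta)) in *. set (c := cos (phi t / beta)) in *.
  assert (hc : Rabs c <= 1) by apply Rabs_cos_le_1.
  assert (hsn : Rabs (sin (phi t - phis)) <= 1) by apply Rabs_sin_le_1.
  set (sn := sin (phi t - phis)) in *.
  rewrite Rminus_0_r in h6, h7.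
  assert (scale : forall x, Rabs (x / s t) < 1 -> Rabs x <= s t).
  { intros x hx. unfold Rdiv in hx.
    rewrite Rabs_mult, (Rabs_pos_eq (/ _)) in hx by (apply Rlt_le, Rinv_0_lt_compat, hs).
    apply Rlt_le, (Rmult_lt_reg_r (/ s t)); [now apply Rinv_0_lt_compat|].
    rewrite Rinv_r by lra. exact hx. }
  apply scale in h6, h7.
  assert (e : rho t = u t * cos (theta t) + v t * sin (theta t)).
  { rewrite h2, h3. pose proof (sin2_cos2 (theta t)) as e. unfold Rsqr in e.
    transitivity (rho t * (sin (theta t) * sin (theta t) + cos (theta t) * cos (theta t)));
      [rewrite e; ring|ring]. }
  assert (hur : rho t <= Rabs (u t) + Rabs (v t)).
  { rewrite e. eapply Rle_trans; [apply Rle_abs|]. eapply Rle_trans; [apply Rabs_triang|].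
    rewrite !Rabs_mult. pose proof (Rabs_cos_le_1 (theta t)). pose proof (Rabs_sin_le_1 (theta t)).
    pose proof (Rabs_pos (u t)). pose proof (Rabs_pos (v t)). nra. }
  assert (prod : forall x y z, Rabs y <= 1 -> 0 < z <= s t -> Rabs (x * (z * y)) <= Rabs x * s t).
  { intros x y z hy hz. rewrite !Rabs_mult, (Rabs_pos_eq z) by lra.
    pose proof (Rabs_pos x). pose proof (Rabs_pos y).
    apply Rmult_le_compat_l; [assumption|]. nra. }
  pose proof (prod m sn (r t) hsn ltac:(lra)) as k1.
  pose proof (prod a c p hc ltac:(lra)) as k2.
  pose proof (prod b c p hc ltac:(lra)) as k3.
  replace (m * r t * sn) with (m * (r t * sn)) in h6 by ring.
  pose proof (Rabs_triang (u t + m * (r t * sn) - a * (p * c)) (a * (p * c) - m * (r t * sn))) as t1.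
  replace (u t + m * (r t * sn) - a * (p * c) + (a * (p * c) - m * (r t * sn)))
    with (u t) in t1 by ring.
  pose proof (Rabs_triang (a * (p * c)) (- (m * (r t * sn)))) as t2. rewrite Rabs_Ropp in t2.
  pose proof (Rabs_triang (v t - b * (p * c)) (b * (p * c))) as t3.
  replace (v t - b * (p * c) + b * (p * c)) with (v t) in t3 by ring.
  unfold Rminus at 2 in t1. lra.
Qed.

(** Once the power term of the vanishing combination is negligible against [r],
    the linear term must vanish in the limit, and [sin theta0 <> 0] leaves only
    the factor [sin (phi - phis)]; inside the sector its one zero is [phis]. *)
Lemma preimage_tends_to_phi_star (beta m phis a b theta0 : R) (r phi u v theta : R -> R) :
  corner_asymptotics beta m phis a b r phi u v ->
  at_right 0 (fun t => u t * sin (theta t) = v t * cos (theta t)) ->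
  m <> 0 -> sin theta0 <> 0 -> lim0 theta theta0 ->
  Rabs phis < PI - PI * beta / 2 ->
  lim0 (fun t => Rpower (r t) (1 / beta) / r t *
        (cos (phi t / beta) * (a * sin (theta t) - b * cos (theta t)))) 0 ->
  lim0 phi phis.
Proof.
  intros hA hx hm hs hth hphis hD. apply Rabs_def2 in hphis.
  assert (hst : lim0 (fun t => m * sin (theta t)) (m * sin theta0)).
  { apply lim0_mult; [apply lim0_const|]. apply (lim0_comp theta sin); [exact hth|].
    apply continuous_sin. }
  assert (hms : m * sin theta0 <> 0) by now apply Rmult_integral_contrapositive.
  assert (hsin : lim0 (fun t => sin (phi t - phis)) 0).
  { replace 0 with ((0 + 0) / (m * sin theta0)) by (field; split; assumption).
    refine (lim0_ext _ _ _ _ (lim0_div _ _ _ _ hms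
      (lim0_plus _ _ _ _ (cross_linear_scale _ _ _ _ _ _ _ _ _ _ hA hx) hD) hst)).
    assert (hne : 0 < Rabs (m * sin theta0)) by now apply Rabs_pos_lt.
    eventually (proj1 (lim0_iff _ _) hst _ hne) as h.
    assert (h0 : m * sin (theta t) <> 0).
    { intros h0. rewrite h0 in h. rewrite Rminus_0_l, Rabs_Ropp in h. lra. }
    match goal with |- (?A - ?B + ?B) / ?E = _ => replace (A - B + B) with A by ring end.
    field. split; intros h1; apply h0; rewrite h1; ring. }
  apply (lim0_of_unique_zero (- (PI * beta / 2)) (PI * beta / 2) phis
    (fun x => Rabs (sin (x - phis)))).
  - intros y. apply continuous_Rabs_comp, continuous_sin_shift.
  - intros y hy h. pose proof (Rabs_pos (sin (y - phis))) as h0.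
    assert (e : sin (y - phis) = 0).
    { destruct (Req_dec (sin (y - phis)) 0) as [e|e]; [exact e|].
      apply Rabs_pos_lt in e. lra. }
    apply sin_eq_0_in_period in e; lra.
  - apply (ca_range _ _ _ _ _ _ _ _ _ hA).
  - replace 0 with (Rabs 0) by apply Rabs_R0.
    apply (lim0_comp _ Rabs); [exact hsin|apply continuous_Rabs].
Qed.

(** The number [e] is a sign.  The vanishing of [cos (phi / beta)] leaves only
    the two sides of the corner, where [sin (phi - phis)] has opposite signs. *)
Lemma tends_to_side (beta phis e : R) (phi g : R -> R) :
  0 < beta < 2 -> e = 1 \/ e = -1 ->
  Rabs phis < PI * beta / 2 -> Rabs phis < PI - PI * beta / 2 ->
  at_right 0 (fun t => - (PI * beta / 2) <= phi t <= PI * beta / 2) ->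
  lim0 (fun t => cos (phi t / beta)) 0 ->
  lim0 g 0 -> at_right 0 (fun t => e * sin (phi t - phis) <= g t) ->
  lim0 phi (- e * (PI * beta / 2)).
Proof.
  intros hb he hp1 hp2 hrange hc hg hs. pose proof PI_RGT_0 as hpi.
  apply Rabs_def2 in hp1, hp2.
  apply (lim0_of_unique_zero (- (PI * beta / 2)) (PI * beta / 2) _
    (* [Rabs x + x] is twice the positive part of [x] *)
    (fun x => Rabs (cos (x / beta)) + (Rabs (e * sin (x - phis)) + e * sin (x - phis)))).
  - intros y. apply (continuous_plus (V := R_NormedModule)).
    + apply continuous_Rabs_comp, continuous_cos_scaled.
    + assert (h : continuous (fun x => e * sin (x - phis)) y).
      { apply (continuous_mult (K := R_AbsRing) (fun _ => e));
          [apply continuous_const|apply continuous_sin_shift]. }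
      apply (continuous_plus (V := R_NormedModule)); [|exact h].
      apply continuous_Rabs_comp, h.
  - intros y hy h.
    assert (hy2 : - (PI / 2) <= y / beta <= PI / 2).
    { assert (e0 : y / beta * beta = y) by (field; lra).
      split; apply (Rmult_le_reg_r beta); lra. }
    pose proof (Rabs_pos (cos (y / beta))) as h0.
    pose proof (Rle_abs (- (e * sin (y - phis)))) as h1. rewrite Rabs_Ropp in h1.
    pose proof (Rle_abs (e * sin (y - phis))) as h2.
    assert (hcos : cos (y / beta) = 0).
    { destruct (Req_dec (cos (y / beta)) 0) as [hz|hz]; [exact hz|].
      apply Rabs_pos_lt in hz. lra. }
    assert (hsin : e * sin (y - phis) <= 0) by lra.
    assert (hend : y / beta = PI / 2 \/ y / beta = - (PI / 2)).
    { destruct (Req_dec (y / beta) (PI / 2)) as [h3|h3]; [now left|].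
      destruct (Req_dec (y / beta) (- (PI / 2))) as [h4|h4]; [now right|].
      pose proof (cos_gt_0 (y / beta)). lra. }
    assert (hy3 : y = y / beta * beta) by (field; lra).
    destruct hend as [h3|h3]; rewrite h3 in hy3; destruct he as [-> | ->]; try lra.
    + pose proof (sin_gt_0 (y - phis)). lra.
    + pose proof (sin_gt_0 (- (y - phis))) as h4. rewrite sin_neg in h4. lra.
  - exact hrange.
  - replace 0 with (Rabs 0 + 0) by (rewrite Rabs_R0; ring). apply lim0_plus.
    { apply (lim0_comp _ Rabs); [exact hc|apply continuous_Rabs]. }
    apply (lim0_squeeze _ (fun t => 2 * Rabs (g t))).
    + eventually hs as h. pose proof (Rle_abs (g t)) as h1.
      pose proof (Rabs_pos (g t)).
      set (x := e * sin (phi t - phis)) in *.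
      unfold Rabs at 1 2. repeat destruct Rcase_abs; lra.
    + replace 0 with (2 * Rabs 0) by (rewrite Rabs_R0; ring).
      apply lim0_mult; [apply lim0_const|].
      apply (lim0_comp _ Rabs); [exact hg|apply continuous_Rabs].
Qed.

(** Contact with the segment gives [v = o (r^{1/beta})], which forces
    [cos (phi / beta)] to [0]; the sign of [u] then selects the side. *)
Lemma preimage_of_segment_direction (beta m phis a b theta0 : R) (r phi u v rho theta : R -> R) :
  corner_asymptotics beta m phis a b r phi u v ->
  at_right 0 (fun t => 0 < rho t /\ u t = rho t * cos (theta t) /\ v t = rho t * sin (theta t)) ->
  0 < beta < 1 -> 0 < m -> b <> 0 ->
  Rabs phis < PI * beta / 2 -> Rabs phis < PI - PI * beta / 2 ->
  theta0 = 0 \/ theta0 = PI -> lim0 theta theta0 ->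
  lim0 (fun t => (theta t - theta0) / Rpower (rho t) (1 / beta - 1)) 0 ->
  lim0 phi (- cos theta0 * (PI * beta / 2)).
Proof.
  intros hA hpol hb hm hb0 hp1 hp2 hth0 hth hcontact.
  pose proof (ca_pos _ _ _ _ _ _ _ _ _ hA) as hpos.
  assert (hct : (cos theta0 = 1 \/ cos theta0 = -1) /\ sin theta0 = 0).
  { destruct hth0 as [-> | ->]; rewrite ?cos_0, ?sin_0, ?cos_PI, ?sin_PI; lra. }
  destruct hct as [hct hst].
  assert (hcc : cos theta0 * cos theta0 = 1) by (destruct hct as [-> | ->]; lra).
  assert (hpr := lim0_power_ratio_small beta r hb hpos (ca_vertex _ _ _ _ _ _ _ _ _ hA)).
  assert (hbound : at_right 0 (fun t => 0 < rho t <= (Rabs m + Rabs a + Rabs b + 2) * r t)).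
  { refine (image_radius_bound beta m phis a b r phi u v rho theta r hpol _ _
      (ca_u_r _ _ _ _ _ _ _ _ _ hA) (ca_v_r _ _ _ _ _ _ _ _ _ hA)).
    - eventually hpos as h. lra.
    - now apply eventually_le_of_negligible. }
  set (M := Rabs m + Rabs a + Rabs b + 2) in *.
  assert (hq : 0 <= 1 / beta - 1).
  { apply (Rmult_le_reg_r beta); [lra|]. rewrite Rmult_minus_distr_r.
    unfold Rdiv. rewrite Rmult_assoc, Rinv_l by lra. lra. }
  assert (hsr := lim0_Rpower_transfer _ r rho M _ hq hpos hbound
    (lim0_contact_sin _ _ _ _ hst hcc hcontact)).
  assert (hvp : lim0 (fun t => v t / Rpower (r t) (1 / beta)) 0).
  { refine (lim0_ext _ _ _ _ (lim0_bounded_mult (fun t => rho t / r t) _ M _ hsr)).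
    - eventually (filter_and _ _ hpol hpos) as [[h1 [h2 h3]] h4]. rewrite h3.
      replace (Rpower (r t) (1 / beta)) with (Rpower (r t) (1 / beta - 1) * r t).
      + field. split; [lra|apply Rgt_not_eq, exp_pos].
      + transitivity (Rpower (r t) (1 / beta - 1) * Rpower (r t) 1).
        * now rewrite (Rpower_1 (r t)).
        * rewrite <- Rpower_plus. f_equal. ring.
    - eventually (filter_and _ _ hbound hpos) as [h1 h2].
      rewrite Rabs_pos_eq by (apply Rlt_le, Rdiv_lt_0_compat; lra).
      apply (Rmult_le_reg_r (r t)); [exact h2|].
      unfold Rdiv. rewrite Rmult_assoc, Rinv_l by lra. lra. }
  assert (hcos : lim0 (fun t => cos (phi t / beta)) 0).
  { replace 0 with ((0 - 0) / b) by (field; exact hb0).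
    refine (lim0_ext _ _ _ _ (lim0_div _ _ _ _ hb0
      (lim0_minus _ _ _ _ hvp (ca_v_p _ _ _ _ _ _ _ _ _ hA)) (lim0_const b))).
    apply (filter_forall (F := at_right 0)). intros t. field.
    split; [apply Rgt_not_eq, exp_pos|exact hb0]. }
  apply (tends_to_side beta phis (cos theta0) phi
    (fun t => cos theta0 / m * ((u t + m * r t * sin (phi t - phis)
       - a * (Rpower (r t) (1 / beta) * cos (phi t / beta))) / r t
       + a * cos (phi t / beta) * (Rpower (r t) (1 / beta) / r t)))); try assumption.
  - lra.
  - apply (ca_range _ _ _ _ _ _ _ _ _ hA).
  - replace 0 with (cos theta0 / m * (0 + a * 0 * 0)) by ring.
    apply lim0_mult; [apply lim0_const|].
    apply lim0_plus; [apply (ca_u_r _ _ _ _ _ _ _ _ _ hA)|].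
    apply lim0_mult; [|exact hpr]. apply lim0_mult; [apply lim0_const|exact hcos].
  (* the image point eventually has a real part of the sign of [cos theta0] *)
  - assert (hcl : lim0 (fun t => cos theta0 * cos (theta t)) 1).
    { rewrite <- hcc. apply lim0_mult; [apply lim0_const|].
      apply (lim0_comp theta cos); [exact hth|apply continuous_cos]. }
    eventually (filter_and _ _ (filter_and _ _ hpol hpos) (lim0_near _ _ 1 Rlt_0_1 hcl))
      as [[[h1 [h2 h3]] h4] h5].
    replace (cos theta0 / m * ((u t + m * r t * sin (phi t - phis)
       - a * (Rpower (r t) (1 / beta) * cos (phi t / beta))) / r t
       + a * cos (phi t / beta) * (Rpower (r t) (1 / beta) / r t)))
      with (cos theta0 * sin (phi t - phis) + rho t * (cos theta0 * cos (theta t)) / (m * r t)).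
    + assert (0 <= rho t * (cos theta0 * cos (theta t)) / (m * r t)); [|lra].
      apply Rlt_le, Rdiv_lt_0_compat; nra.
    + rewrite h2. field. lra.
Qed.

(** On the scale [r^{1/beta}] the vanishing combination
    [u sin theta - v cos theta] forces [cos (phi / beta)] to [0].  On the scale
    [r] the surviving term has the sign of [theta0 - thetas], which selects the
    side. *)
Lemma preimage_of_transversal_direction (beta m phis R0 thetas theta0 e : R)
    (r phi u v theta : R -> R) :
  corner_asymptotics beta m phis (R0 * cos thetas) (R0 * sin thetas) r phi u v ->
  at_right 0 (fun t => u t * sin (theta t) = v t * cos (theta t)) ->
  1 < beta < 2 -> 0 < m -> 0 < R0 ->
  Rabs phis < PI * beta / 2 -> Rabs phis < PI - PI * beta / 2 ->
  e = 1 \/ e = -1 -> 0 < sin theta0 -> e * sin (theta0 - thetas) < 0 -> lim0 theta theta0 ->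
  lim0 phi (- e * (PI * beta / 2)).
Proof.
  intros hA hx hb hm hR hp1 hp2 he hs0 hes hth. pose proof PI_RGT_0 as hpi.
  pose proof (ca_pos _ _ _ _ _ _ _ _ _ hA) as hpos.
  set (d := fun t => R0 * sin (theta t - thetas)).
  assert (hd : lim0 d (R0 * sin (theta0 - thetas))).
  { apply lim0_mult; [apply lim0_const|now apply lim0_sin_shift]. }
  assert (hD : forall t, R0 * cos thetas * sin (theta t) - R0 * sin thetas * cos (theta t) = d t).
  { intros t. unfold d. rewrite sin_minus. ring. }
  assert (hst : lim0 (fun t => sin (theta t)) (sin theta0)).
  { apply (lim0_comp theta sin); [exact hth|apply continuous_sin]. }
  assert (hd0 : R0 * sin (theta0 - thetas) <> 0).
  { apply Rmult_integral_contrapositive. split; [lra|]. intros h. rewrite h in hes. lra. }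
  assert (hed : at_right 0 (fun t => e * d t < 0)).
  { assert (h := lim0_mult _ _ _ _ (lim0_const e) hd).
    assert (hneg : 0 < - (e * (R0 * sin (theta0 - thetas)))) by nra.
    eventually (lim0_near _ _ _ hneg h) as h1. lra. }
  assert (hrange : at_right 0 (fun t => 0 <= cos (phi t / beta))).
  { eventually (ca_range _ _ _ _ _ _ _ _ _ hA) as h.
    assert (e1 : phi t / beta * beta = phi t) by (field; lra).
    apply cos_ge_0; apply (Rmult_le_reg_r beta); lra. }
  assert (hcos : lim0 (fun t => cos (phi t / beta)) 0).
  { assert (hrp := lim0_power_ratio_large beta r ltac:(lra) hpos (ca_vertex _ _ _ _ _ _ _ _ _ hA)).
    assert (hlin : lim0 (fun t => m * sin (phi t - phis) * sin (theta t)
        * (r t / Rpower (r t) (1 / beta))) 0).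
    { apply (lim0_bounded_mult _ _ m); [|exact hrp].
      apply (filter_forall (F := at_right 0)). intros t.
      rewrite !Rabs_mult, (Rabs_pos_eq m) by lra.
      pose proof (Rabs_sin_le_1 (phi t - phis)). pose proof (Rabs_sin_le_1 (theta t)).
      pose proof (Rabs_pos (sin (phi t - phis))). pose proof (Rabs_pos (sin (theta t))).
      assert (Rabs (sin (phi t - phis)) * Rabs (sin (theta t)) <= 1) by nra. nra. }
    replace 0 with ((0 - 0) / (R0 * sin (theta0 - thetas))) by (field; split;
      [intros h; apply hd0; rewrite h; ring|lra]).
    refine (lim0_ext _ _ _ _ (lim0_div _ _ _ _ hd0
      (lim0_minus _ _ _ _ hlin (cross_power_scale _ _ _ _ _ _ _ _ _ _ hA hx)) hd)).
    eventually hed as h1. rewrite hD. field.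
    split; [apply Rgt_not_eq, exp_pos|intros h2; rewrite h2 in h1; lra]. }
  set (g := fun t => m * sin (phi t - phis) * sin (theta t)
    - Rpower (r t) (1 / beta) / r t *
        (cos (phi t / beta) * (R0 * cos thetas * sin (theta t) - R0 * sin thetas * cos (theta t)))).
  assert (hms : m * sin theta0 <> 0) by nra.
  apply (tends_to_side beta phis e phi (fun t => e * g t / (m * sin (theta t))));
    try assumption.
  - lra.
  - apply (ca_range _ _ _ _ _ _ _ _ _ hA).
  - replace 0 with (e * 0 / (m * sin theta0)) by (field; split; lra).
    apply lim0_div; [exact hms| |].
    + apply lim0_mult; [apply lim0_const|]. exact (cross_linear_scale _ _ _ _ _ _ _ _ _ _ hA hx).
    + apply lim0_mult; [apply lim0_const|exact hst].
  - eventually (filter_and _ _ (filter_and _ _ hpos hrange)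
      (filter_and _ _ hed (lim0_near _ _ _ hs0 hst))) as [[h1 h2] [h3 h4]].
    assert (hden : 0 < m * sin (theta t)) by (apply Rmult_lt_0_compat; lra).
    apply (Rmult_le_reg_r (m * sin (theta t))); [exact hden|].
    unfold Rdiv. rewrite (Rmult_assoc (e * g t)), Rinv_l, Rmult_1_r by lra.
    unfold g. rewrite hD.
    assert (hpr : 0 < Rpower (r t) (1 / beta) / r t) by (apply Rdiv_lt_0_compat; [apply exp_pos|exact h1]).
    assert (0 <= Rpower (r t) (1 / beta) / r t * cos (phi t / beta) * (- (e * d t))).
    { apply Rmult_le_pos; [apply Rmult_le_pos|]; lra. }
    lra.
Qed.

(** The radius of the image is [O (r^{1/beta})], so contact of order
    [beta - 1] means [theta - thetas = o (r^{1 - 1/beta})]: this is exactly what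
    makes the power term in the vanishing combination [o (r)]. *)
Lemma preimage_of_critical_direction (beta m phis R0 thetas : R)
    (r phi u v rho theta : R -> R) :
  corner_asymptotics beta m phis (R0 * cos thetas) (R0 * sin thetas) r phi u v ->
  at_right 0 (fun t => 0 < rho t /\ u t = rho t * cos (theta t) /\ v t = rho t * sin (theta t)) ->
  1 < beta < 2 -> 0 < m -> 0 < R0 -> 0 < sin thetas ->
  Rabs phis < PI - PI * beta / 2 -> lim0 theta thetas ->
  lim0 (fun t => (theta t - thetas) / Rpower (rho t) (beta - 1)) 0 ->
  lim0 phi phis.
Proof.
  intros hA hpol hb hm hR hs hp2 hth hcontact.
  pose proof (ca_pos _ _ _ _ _ _ _ _ _ hA) as hpos.
  assert (hrp := lim0_power_ratio_large beta r ltac:(lra) hpos (ca_vertex _ _ _ _ _ _ _ _ _ hA)).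
  assert (hppos : at_right 0 (fun t => 0 < Rpower (r t) (1 / beta)))
    by (apply (filter_forall (F := at_right 0)); intros t; apply exp_pos).
  assert (hbound : at_right 0 (fun t => 0 < rho t <=
    (Rabs m + Rabs (R0 * cos thetas) + Rabs (R0 * sin thetas) + 2) * Rpower (r t) (1 / beta))).
  { refine (image_radius_bound beta m phis _ _ r phi u v rho theta _ hpol _ _
      (ca_u_p _ _ _ _ _ _ _ _ _ hA) (ca_v_p _ _ _ _ _ _ _ _ _ hA)).
    - eventually (filter_and _ _ hpos (eventually_le_of_negligible _ _ hppos hrp)) as h. exact h.
    - apply (filter_forall (F := at_right 0)). intros t. apply Rle_refl. }
  assert (hsc := lim0_Rpower_transfer _ _ rho _ (beta - 1) ltac:(lra) hppos hbound hcontact).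
  apply (preimage_tends_to_phi_star beta m phis (R0 * cos thetas) (R0 * sin thetas) thetas
    r phi u v theta); try assumption; try lra.
  - eventually hpol as [h1 [h2 h3]]. rewrite h2, h3. ring.
  - apply (lim0_squeeze _ (fun t => R0 * Rabs ((theta t - thetas)
      / Rpower (Rpower (r t) (1 / beta)) (beta - 1)))).
    + eventually hpos as h. rewrite Rpower_mult.
      replace (1 / beta * (beta - 1)) with (1 - 1 / beta) by (field; lra).
      rewrite <- Rpower_ratio, (Rpower_1 (r t)) by exact h.
      assert (hpp : 0 < Rpower (r t) (1 / beta)) by apply exp_pos.
      set (p := Rpower (r t) (1 / beta)) in *.
      replace ((theta t - thetas) / (r t / p)) with ((theta t - thetas) * (p / r t)) by (field; lra).
      replace (p / r t * (cos (phi t / beta) *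
         (R0 * cos thetas * sin (theta t) - R0 * sin thetas * cos (theta t))))
        with (p / r t * (cos (phi t / beta) * (R0 * sin (theta t - thetas))))
        by (rewrite sin_minus; ring).
      assert (hpr : 0 < p / r t) by (apply Rdiv_lt_0_compat; lra).
      rewrite !Rabs_mult, (Rabs_pos_eq (p / r t)), (Rabs_pos_eq R0) by lra.
      pose proof (Rabs_sin_le (theta t - thetas)) as k1.
      pose proof (Rabs_cos_le_1 (phi t / beta)) as k2.
      pose proof (Rabs_pos (sin (theta t - thetas))) as k3.
      pose proof (Rabs_pos (cos (phi t / beta))) as k4.
      assert (k5 : Rabs (cos (phi t / beta)) * Rabs (sin (theta t - thetas))
        <= Rabs (theta t - thetas)) by nra.
      assert (k6 : 0 <= p / r t * R0) by (apply Rlt_le, Rmult_lt_0_compat; lra).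
      pose proof (Rmult_le_compat_l _ _ _ k6 k5). lra.
    + replace 0 with (R0 * Rabs 0) by (rewrite Rabs_R0; ring).
      apply lim0_mult; [apply lim0_const|].
      apply (lim0_comp _ Rabs); [exact hsc|apply continuous_Rabs].
Qed.

(** * The angle correspondences *)

Theorem theorem4p2
  (beta Rad sp sm lp lm a1 b1 : R)
  (Z W H : C -> Prop) (F Finv : C -> C)
  (hbeta : 0 < beta < 2)
  (hRad : 0 < Rad) (hsp : 0 < sp) (hsm : 0 < sm) (hlp : 0 < lp) (hlm : 0 < lm)
  (hZ : planar_domain Z)
  (hSZ : forall z, sector beta Rad z -> Z z)
  (hLZ : forall z, corner_contour beta Rad z -> frontier Z z)
  (hW : planar_domain W)
  (hIW : forall w, segment lm lp w -> frontier W w)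
  (hHW : forall w, H w -> W w)
  (hH : upper_part H lm lp)
  (hFZW : forall z, Z z -> W (F z))
  (hFharm : harmonic_map_on Z F)
  (hFcont : continuous_within
              (set_union (sector beta Rad) (corner_contour beta Rad)) F)
  (hFSH : forall z, sector beta Rad z -> H (F z))
  (hFinj : injective_on (sector beta Rad) F)
  (hForient : orientation_preserving_on (sector beta Rad) F)
  (hFL : homeomorphic_onto F (corner_contour beta Rad) (segment lm lp))
  (hFM : F 0%C = 0%C)
  (hFLminus : forall r, 0 < r < Rad ->
     F (polar r (PI * beta / 2)) = (- (sm * r), 0))
  (hFLplus : forall r, 0 < r < Rad ->
     F (polar r (- (PI * beta / 2))) = (sp * r, 0))
  (hFinv : inverse_near_0
             (set_union (sector beta Rad) (corner_contour beta Rad))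
             (set_union H (segment lm lp)) F Finv)
  (ha1 : a1 <> 0) (hb1 : 0 < b1)
  (hexp : beta <> 1 -> corner_expansion beta sp sm a1 b1 F) :
  let phil := - (PI * beta / 2) in
  let phir := PI * beta / 2 in
  let phis := phi_star beta sp sm in
  let thetas := theta_star a1 b1 in
  let ZL := set_union Z (corner_contour beta Rad) in
  let WI := set_union W (segment lm lp) in
  (beta < 1 ->
    (forall (lam : R -> C) (phi : R),
      smooth_jordan_arc ZL lam -> leaves_at_angle phil phir lam phi ->
      (phil <= phi < phis ->
         leaves_at_angle 0 PI (fun t => F (lam t)) 0) /\
      (phi = phis -> tangent_contact phil phir lam phi (1 / beta - 1) ->
         leaves_at_angle 0 PI (fun t => F (lam t)) thetas) /\
      (phis < phi <= phir ->
         leaves_at_angle 0 PI (fun t => F (lam t)) PI)) /\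
    (forall (Lam : R -> C) (theta : R),
      smooth_jordan_arc WI Lam -> leaves_at_angle 0 PI Lam theta ->
      (theta = 0 -> tangent_contact 0 PI Lam theta (1 / beta - 1) ->
         leaves_at_angle phil phir (fun t => Finv (Lam t)) phil) /\
      (0 < theta < PI ->
         leaves_at_angle phil phir (fun t => Finv (Lam t)) phis) /\
      (theta = PI -> tangent_contact 0 PI Lam theta (1 / beta - 1) ->
         leaves_at_angle phil phir (fun t => Finv (Lam t)) phir)))
  /\
  (1 < beta ->
    (forall (lam : R -> C) (phi : R),
      smooth_jordan_arc ZL lam -> leaves_at_angle phil phir lam phi ->
      (phi = phil -> tangent_contact phil phir lam phi (1 - 1 / beta) ->
         leaves_at_angle 0 PI (fun t => F (lam t)) 0) /\
      (phil < phi < phir ->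
         leaves_at_angle 0 PI (fun t => F (lam t)) thetas) /\
      (phi = phir -> tangent_contact phil phir lam phi (1 - 1 / beta) ->
         leaves_at_angle 0 PI (fun t => F (lam t)) PI)) /\
    (forall (Lam : R -> C) (theta : R),
      smooth_jordan_arc WI Lam -> leaves_at_angle 0 PI Lam theta ->
      (0 < theta < thetas ->
         leaves_at_angle phil phir (fun t => Finv (Lam t)) phil) /\
      (theta = thetas -> tangent_contact 0 PI Lam theta (beta - 1) ->
         leaves_at_angle phil phir (fun t => Finv (Lam t)) phis) /\
      (thetas < theta < PI ->
         leaves_at_angle phil phir (fun t => Finv (Lam t)) phir))).
Proof.
  intros phil phir phis thetas ZL WI. pose proof PI_RGT_0 as hpi.
  destruct (theta_star_polar a1 b1 ha1 hb1) as [hthetas [R0 [hR0 [ea eb]]]].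
  fold thetas in hthetas, ea, eb. clearbody thetas.
  assert (hsinth : 0 < sin thetas) by (apply sin_gt_0; lra).
  assert (hwindow : phir - phil < 2 * PI) by (unfold phil, phir; nra).
  assert (hwindow' : PI - 0 < 2 * PI) by lra.
  assert (hphir : 0 < phir) by (unfold phir; nra).
  assert (hends : phil / beta = - (PI / 2) /\ phir / beta = PI / 2).
  { unfold phil, phir. split; field; lra. }
  assert (hinner : forall x, phil < x < phir -> 0 < cos (x / beta)).
  { intros x hx. assert (e : x / beta * beta = x) by (field; lra).
    unfold phil, phir in hx.
    apply cos_gt_0; apply (Rmult_lt_reg_r beta); lra. }
  assert (hphis : beta <> 1 -> Rabs phis < phir /\ Rabs phis < PI - phir).
  { intros hne. now apply phi_star_bounds. }
  assert (hmu : beta <> 1 -> 0 < mu beta sp sm) by (intros hne; now apply mu_pos).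
  assert (hasym : beta <> 1 -> forall g r phi, polar_lift phil phir g r phi ->
    corner_asymptotics beta (mu beta sp sm) phis (R0 * cos thetas) (R0 * sin thetas) r phi
      (fun t => fst (F (g t))) (fun t => snd (F (g t)))).
  { intros hne g r phi hl. rewrite <- ea, <- eb.
    exact (corner_asymptotics_of_expansion _ _ _ _ _ _ _ _ _ hbeta (hexp hne) hl). }
  assert (hup : forall g r phi, polar_lift phil phir g r phi ->
    at_right 0 (fun t => 0 <= snd (F (g t)))).
  { intros g r phi. exact (image_in_upper_half_plane beta Rad sp sm H F g r phi hRad
      (proj1 (proj2 hH)) hFSH hFLminus hFLplus). }
  assert (hpre : forall Lam theta, leaves_at_angle 0 PI Lam theta ->
    exists rho th r phi, polar_lift 0 PI Lam rho th /\ lim0 th theta /\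
      polar_lift phil phir (fun t => Finv (Lam t)) r phi /\
      at_right 0 (fun t => 0 < rho t /\
        fst (F (Finv (Lam t))) = rho t * cos (th t) /\
        snd (F (Finv (Lam t))) = rho t * sin (th t))).
  { intros Lam theta hleave.
    destruct (leaves_at_angle_lift 0 PI theta Lam hwindow' hleave) as [rho [th [hl hth]]].
    destruct (preimage_lift beta Rad sp sm lp lm H F Finv Lam rho th (proj1 hbeta)
      hsp hsm hlp hlm hH hFSH hFM hFLminus hFLplus hFinv hl) as [hFF [r [phi hl']]].
    exists rho, th, r, phi.
    split; [exact hl|split; [exact hth|split; [exact hl'|]]].
    eventually (filter_and _ _ hFF (lift_point _ _ _ _ _ hl)) as [h1 [h2 [h3 h4]]].
    rewrite h1, h4. simpl. auto. }
  split; intros hb.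
  - assert (hne : beta <> 1) by lra. destruct (hphis hne) as [hp1 hp2].
    pose proof (Rabs_def2 _ _ hp1) as hp1'. pose proof (Rabs_def2 _ _ hp2) as hp2'.
    specialize (hmu hne). specialize (hasym hne). clear hphis.
    assert (hratio : forall g r phi, polar_lift phil phir g r phi ->
      forall x M, (forall t, Rabs (x t) <= M) ->
      lim0 (fun t => Rpower (r t) (1 / beta) / r t * x t) 0).
    { intros g r phi hl x M hx. pose proof (hasym _ _ _ hl) as hA.
      refine (lim0_ext _ _ _ _ (lim0_bounded_mult x _ M
        (filter_forall (F := at_right 0) _ hx)
        (lim0_power_ratio_small beta r (conj (proj1 hbeta) hb)
          (ca_pos _ _ _ _ _ _ _ _ _ hA) (ca_vertex _ _ _ _ _ _ _ _ _ hA)))).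
      apply (filter_forall (F := at_right 0)). intros t. ring. }
    split.
    + intros lam phi0 harc hleave.
      destruct (leaves_at_angle_lift _ _ _ _ hwindow hleave) as [r [phi [hl hphi]]].
      pose proof (hasym _ _ _ hl) as hA. pose proof (hup _ _ _ hl) as hv.
      assert (hc := hratio _ _ _ hl (fun t => cos (phi t / beta)) 1
        (fun t => Rabs_cos_le_1 (phi t / beta))).
      split; [|split].
      * intros hlt.
        apply (image_leaves_along_segment _ _ _ _ _ _ _ _ _ _ hA hv hphi hmu hc); [now left|].
        rewrite cos_0, Rmult_1_l. apply sin_lt_0_var; unfold phil, phir in *; lra.
      * intros -> hcontact.
        pose proof (tangent_contact_lift _ _ _ _ _ _ _ _ hwindow harc hl hphi hcontact) as hq.
        refine (image_leaves_transversally _ _ _ _ _ _ _ _ _ hA hv hphi (proj1 hbeta) hR0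
          _ _ (contact_sin_quotient _ _ _ _ (proj1 hbeta) (ca_pos _ _ _ _ _ _ _ _ _ hA) hq)).
        -- lra.
        -- apply hinner. unfold phil, phir in *. lra.
      * intros hgt.
        apply (image_leaves_along_segment _ _ _ _ _ _ _ _ _ _ hA hv hphi hmu hc); [now right|].
        rewrite cos_PI. assert (0 < sin (phi0 - phis)); [|lra].
        apply sin_gt_0; unfold phil, phir in *; lra.
    + intros Lam theta0 harc hleave.
      destruct (hpre _ _ hleave) as [rho [th [r [phi [hL [hth [hl hpol]]]]]]].
      pose proof (hasym _ _ _ hl) as hA.
      assert (hend : theta0 = 0 \/ theta0 = PI ->
        tangent_contact 0 PI Lam theta0 (1 / beta - 1) ->
        lim0 phi (- cos theta0 * phir)).
      { intros ht0 hcontact.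
        pose proof (tangent_contact_lift _ _ _ _ _ _ _ _ hwindow' harc hL hth hcontact) as hq.
        refine (preimage_of_segment_direction _ _ _ _ _ _ _ _ _ _ _ _ hA hpol
          (conj (proj1 hbeta) hb) hmu _ hp1 hp2 ht0 hth hq). nra. }
      split; [|split].
      * intros e hcontact. apply (leaves_at_angle_of_lift _ _ _ _ _ _ hl).
        pose proof (hend (or_introl e) hcontact) as h. rewrite e, cos_0 in h.
        replace phil with (- (1) * phir) by (unfold phil, phir; ring). exact h.
      * intros ht. apply (leaves_at_angle_of_lift _ _ _ _ _ _ hl).
        refine (preimage_tends_to_phi_star _ _ _ _ _ theta0 _ _ _ _ th hA _ _ _ hth hp2 _).
        -- eventually hpol as [h1 [-> ->]]. ring.
        -- lra.
        -- apply Rgt_not_eq, sin_gt_0; lra.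
        -- apply (hratio _ _ _ hl (fun t => cos (phi t / beta) *
             (R0 * cos thetas * sin (th t) - R0 * sin thetas * cos (th t)))
             (Rabs (R0 * cos thetas) + Rabs (R0 * sin thetas))).
           intros t. rewrite Rabs_mult.
           pose proof (Rabs_combination_le (sin (th t)) (cos (th t)) (R0 * cos thetas)
             (R0 * sin thetas) (Rabs_sin_le_1 _) (Rabs_cos_le_1 _)) as k.
           pose proof (Rabs_cos_le_1 (phi t / beta)). pose proof (Rabs_pos (cos (phi t / beta))).
           pose proof (Rabs_pos (R0 * cos thetas * sin (th t) - R0 * sin thetas * cos (th t))).
           nra.
      * intros e hcontact. apply (leaves_at_angle_of_lift _ _ _ _ _ _ hl).
        pose proof (hend (or_intror e) hcontact) as h. rewrite e, cos_PI in h.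
        replace phir with (- (-1) * phir) by ring. exact h.
  - assert (hne : beta <> 1) by lra. destruct (hphis hne) as [hp1 hp2].
    pose proof (Rabs_def2 _ _ hp1) as hp1'. pose proof (Rabs_def2 _ _ hp2) as hp2'.
    specialize (hmu hne). specialize (hasym hne). clear hphis.
    split.
    + intros lam phi0 harc hleave.
      destruct (leaves_at_angle_lift _ _ _ _ hwindow hleave) as [r [phi [hl hphi]]].
      pose proof (hasym _ _ _ hl) as hA. pose proof (hup _ _ _ hl) as hv.
      pose proof (ca_pos _ _ _ _ _ _ _ _ _ hA) as hpos.
      assert (hend : cos (phi0 / beta) = 0 -> tangent_contact phil phir lam phi0 (1 - 1 / beta) ->
        lim0 (fun t => Rpower (r t) (1 / beta) / r t * cos (phi t / beta)) 0).
      { intros hc hcontact.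
        pose proof (tangent_contact_lift _ _ _ _ _ _ _ _ hwindow harc hl hphi hcontact) as hq.
        exact (contact_cos_quotient _ _ _ _ (proj1 hbeta) hc hpos hq). }
      split; [|split].
      * intros e hcontact.
        assert (hc : cos (phi0 / beta) = 0).
        { rewrite e, (proj1 hends), cos_neg. apply cos_PI2. }
        apply (image_leaves_along_segment _ _ _ _ _ _ _ _ _ _ hA hv hphi hmu (hend hc hcontact));
          [now left|].
        rewrite e, cos_0, Rmult_1_l. apply sin_lt_0_var; unfold phil, phir in *; lra.
      * intros hmid.
        refine (image_leaves_transversally _ _ _ _ _ _ _ _ _ hA hv hphi (proj1 hbeta) hR0
          _ (hinner _ hmid) _); [lra|].
        refine (lim0_ext _ _ _ _ (lim0_bounded_mult (fun t => sin (phi t - phis)) _ 1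
          (filter_forall (F := at_right 0) _ (fun t => Rabs_sin_le_1 _))
          (lim0_power_ratio_large beta r hb hpos (ca_vertex _ _ _ _ _ _ _ _ _ hA)))).
        apply (filter_forall (F := at_right 0)). intros t. ring.
      * intros e hcontact.
        assert (hc : cos (phi0 / beta) = 0).
        { rewrite e, (proj2 hends). apply cos_PI2. }
        apply (image_leaves_along_segment _ _ _ _ _ _ _ _ _ _ hA hv hphi hmu (hend hc hcontact));
          [now right|].
        rewrite e, cos_PI. assert (0 < sin (phir - phis)); [|lra].
        apply sin_gt_0; unfold phil, phir in *; lra.
    + intros Lam theta0 harc hleave.
      destruct (hpre _ _ hleave) as [rho [th [r [phi [hL [hth [hl hpol]]]]]]].
      pose proof (hasym _ _ _ hl) as hA.
      assert (hx : at_right 0 (fun t => fst (F (Finv (Lam t))) * sin (th t)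
        = snd (F (Finv (Lam t))) * cos (th t)))
        by (eventually hpol as [h1 [-> ->]]; ring).
      split; [|split].
      * intros ht. apply (leaves_at_angle_of_lift _ _ _ _ _ _ hl).
        replace phil with (- (1) * phir) by (unfold phil, phir; ring).
        refine (preimage_of_transversal_direction _ _ _ _ _ theta0 1 _ _ _ _ th hA hx
          (conj hb (proj2 hbeta)) hmu hR0 hp1 hp2 (or_introl eq_refl) _ _ hth).
        -- apply sin_gt_0; lra.
        -- rewrite Rmult_1_l. apply sin_lt_0_var; lra.
      * intros -> hcontact. apply (leaves_at_angle_of_lift _ _ _ _ _ _ hl).
        pose proof (tangent_contact_lift _ _ _ _ _ _ _ _ hwindow' harc hL hth hcontact) as hq.
        exact (preimage_of_critical_direction _ _ _ _ _ _ _ _ _ _ _ hA hpol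
          (conj hb (proj2 hbeta)) hmu hR0 hsinth hp2 hth hq).
      * intros ht. apply (leaves_at_angle_of_lift _ _ _ _ _ _ hl).
        replace phir with (- (-1) * phir) by ring.
        refine (preimage_of_transversal_direction _ _ _ _ _ theta0 (-1) _ _ _ _ th hA hx
          (conj hb (proj2 hbeta)) hmu hR0 hp1 hp2 (or_intror eq_refl) _ _ hth).
        -- apply sin_gt_0; lra.
        -- assert (0 < sin (theta0 - thetas)) by (apply sin_gt_0; lra). lra.
Qed.
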